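(* There exist a continuous function $f\in C(\mathbb{T}^2)$ and a complete sequence of balls $U_k\subset\mathbb{R}^2$, $k=1,2,\ldots$, such that $\tau(U_k)\to 0$ as $k\to\infty$ and $$\limsup_{k\to\infty}|S_{U_k}(x,y,f)|=\infty$$ for almost every $(x,y)\in\mathbb{T}^2$.
   Context: $\mathbb{T}=\mathbb{R}/(2\pi\mathbb{Z})$, $\mathbb{T}^2=\mathbb{T}\times\mathbb{T}$, with Lebesgue measure. Continuous functions may be complex-valued. For $f\in L^1(\mathbb{T}^2)$ with double Fourier series $\sum_{n,m=-\infty}^{+\infty}c_{nm}e^{i(nx+my)}$ and a bounded region $G\subset\mathbb{R}^2$, the partial sum over $G$ is $$S_G(x,y,f)=\sum_{(n,m)\in G}c_{nm}e^{i(nx+my)}$$ (the sum is over integer points $(n,m)\in\mathbb{Z}^2\cap G$). $B=B(x_0,y_0,r)\subset\mathbb{R}^2$ is the open ball with center $(x_0,y_0)$ and radius $r>0$, and $$\tau(B)=\frac{\sqrt{x_0^2+y_0^2}}{r}.$$ A sequence of regions $G_k$ is complete if $\bigcup_{k=1}^\infty G_k=\mathbb{R}^2$. *)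

(* Defs.v *)
(* MathComp world (MathComp-Analysis, with R[i] from real-closed). *)
From HB Require Import structures.
From mathcomp Require Import all_boot all_order all_algebra.
From mathcomp Require Import all_classical all_reals all_analysis.
From mathcomp Require Import complex.

Set Implicit Arguments.
Unset Strict Implicit.
Unset Printing Implicit Defensive.

Import Order.TTheory GRing.Theory Num.Theory.
Import numFieldNormedType.Exports.

Local Open Scope classical_set_scope.
Local Open Scope ring_scope.
Local Open Scope complex_scope.

(* The topology on R[i] is the one given by its modulus, which MathComp-Analysis
   provides for R[i]^o but not for R[i] itself. *)
HB.instance Definition _ (R : realType) :=
  NormedModule.copy R[i] ((R[i] : numFieldType)^o).

Section Torus.
Context {R : realType}.

(* A function on T^2, T = R / 2 pi Z, is a function on R * R that is
   2 pi-periodic in each variable. *)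
Definition continuous_on_torus (f : R * R -> R[i]) : Prop :=
  [/\ continuous f, periodic f (pi *+ 2, 0) & periodic f (0, pi *+ 2)].

(* Half-open, so that each point of T^2 has exactly one representative. *)
Definition torus : set (R * R) := `[0, pi *+ 2[ `*` `[0, pi *+ 2[.

Definition lebesgue2 := (@lebesgue_measure R \x @lebesgue_measure R)%E.

Definition expi (t : R) : R[i] := cos t +i* sin t.

Definition cintegral (D : set (R * R)) (g : R * R -> R[i]) : R[i] :=
  Rintegral lebesgue2 D (fun z => complex.Re (g z)) +i*
  Rintegral lebesgue2 D (fun z => complex.Im (g z)).

Definition fourier_coef (f : R * R -> R[i]) (n m : int) : R[i] :=
  ((pi *+ 2) ^+ 2)^-1%:C *
  cintegral torus (fun z => f z * expi (- (n%:~R * z.1 + m%:~R * z.2))).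

(* Meant for bounded G, which contains finitely many integer points: otherwise
   \sum_(p \in A) is 0 by convention when infinitely many terms are nonzero. *)
Definition partial_sum (G : set (R * R)) (f : R * R -> R[i]) (x y : R) : R[i] :=
  \sum_(p \in [set p : int * int | G (p.1%:~R, p.2%:~R)])
    fourier_coef f p.1 p.2 * expi (p.1%:~R * x + p.2%:~R * y).

(* Discs are Euclidean: the library's [ball] on R * R is a square. *)
Record disc := Disc {
  disc_center : R * R;
  disc_radius : R;
  disc_radius_gt0 : 0 < disc_radius
}.

Definition disc_set (B : disc) : set (R * R) :=
  [set z | Num.sqrt ((z.1 - (disc_center B).1) ^+ 2
                     + (z.2 - (disc_center B).2) ^+ 2) < disc_radius B].

Definition tau (B : disc) : R :=
  Num.sqrt ((disc_center B).1 ^+ 2 + (disc_center B).2 ^+ 2) / disc_radius B.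

Definition complete_seq (G : nat -> set (R * R)) : Prop :=
  \bigcup_k G k = setT.

End Torus.

Arguments disc R : clear implicits.

(* Main.v *)
(* For a trigonometric polynomial F multiplied by e^{iNx}, N large, a disc whose
   boundary passes through (N, 0) acts on the coefficients of F as a half-plane
   {a + s b < 0}.  The slope s > 0 may be as small as desired but is otherwise
   free, and the disc with center (0, -sN) has tau <= s.  So it suffices to find
   F with |F| <= 1 having, off a set of small measure, a large half-plane sum
   with a slope depending on the point.

   F is built along a binary tree of depth n.  Each node h carries a frequency
   p_h, with magnitudes increasing very fast with the level, and F is
   essentially the sum of c cos(p_h z) over the path of nodes followed by z,
   which turns left or right according to the sign of sin(p_h z).  The terms are
   orthogonal, so F stays bounded for c of order n^{-1/2}.  The p_h are ordered by
   slope as in a binary search tree, hence for every path there is a half-plane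
   that picks e^{i p_h z} at the nodes where sin(p_h z) > 0 and e^{-i p_h z} at the
   others.  The imaginary part of the corresponding half-plane sum is about
   (c/2) sum |sin(p_h z)| over the path, of order c n, that is n^{1/2}. *)
Require Import Defs.
From HB Require Import structures.
From mathcomp Require Import all_boot all_order all_algebra.
From mathcomp Require Import all_classical all_reals all_analysis.
From mathcomp Require Import complex.
From mathcomp Require Import measurable_realfun ring lra zify.

Set Implicit Arguments.
Unset Strict Implicit.
Unset Printing Implicit Defensive.

Import Order.TTheory GRing.Theory Num.Theory.
Import numFieldNormedType.Exports.

Local Open Scope classical_set_scope.
Local Open Scope ring_scope.
Local Open Scope complex_scope.

(** * Trigonometric polynomials *)

Section TrigonometricPolynomials.
Context {R : realType}.
Implicit Types (p q : int * int) (z : R * R) (D : nat).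

(** The turns in the tree must be made by trigonometric polynomials. The indicator of a path is
    therefore replaced by a product of polynomial approximations of the sign of the sine, and a
    point may be shared between several leaves. For a node, all that was built at earlier levels is
    a coefficient of much lower degree than its own frequency. Cross terms between levels then
    integrate to zero, as for martingale differences, so mean squares control every way in which a
    point can go wrong, and Markov's inequality gives an exceptional set of small measure.

    A large disc cuts the shifted spectrum exactly as a half-plane does: on that finite spectrum the
    half-plane form takes nonzero integer values, and the curvature of the circle contributes less
    than one unit. A block needs only [2 ^ n] slopes, all below [2 ^ n / Q] with [Q] free, so it
    uses finitely many discs, and their [tau] is small.

    Blocks of size [2 ^- k], shifted far apart, add up uniformly. Their exceptional sets have
    measure at most [2 ^- k], so almost every point escapes infinitely many of them, which suffices
    for an upper limit. *)

Definition dot p z : R := p.1%:~R * z.1 + p.2%:~R * z.2.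

Definition expchar p z : R[i] := expi (dot p z).

(** A polynomial is given by a list in which frequencies may repeat: sums are concatenations,
    restricting the spectrum is a [filter], and no normal form is required. *)
Definition eval_tp (T : seq ((int * int) * R[i])) z : R[i] :=
  \sum_(t <- T) t.2 * expchar t.1 z.

Definition freq_le D p := (`|p.1| <= D)%N && (`|p.2| <= D)%N.

Definition trig_poly D (f : R * R -> R[i]) :=
  exists2 T, all (fun t => freq_le D t.1) T & f =1 eval_tp T.

Lemma dotDl p q z : dot (p + q) z = dot p z + dot q z.
Proof. by rewrite /dot /= !intrD !mulrDl addrACA. Qed.

Lemma dotNl p z : dot (- p) z = - dot p z.
Proof. by rewrite /dot /= !mulrNz !mulNr opprD. Qed.

Lemma dot0l z : dot 0 z = 0.
Proof. by rewrite /dot /= !mul0r addr0. Qed.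

Lemma dotMnl p k z : dot (p *+ k) z = dot p z *+ k.
Proof.
by elim: k => [|k IH]; rewrite ?mulr0n ?dot0l// !mulrS dotDl IH.
Qed.

Lemma expiD (s t : R) : expi (s + t) = expi s * expi t.
Proof. by rewrite /expi cosD sinD; simpc; rewrite [in X in _ +i* X]addrC. Qed.

Lemma expi0 : expi (0 : R) = 1.
Proof. by rewrite /expi cos0 sin0. Qed.

Lemma expi_cos_sin (t : R) : expi t = (cos t)%:C + 'i * (sin t)%:C.
Proof. by rewrite /expi; simpc. Qed.

Lemma cos_expi (t : R) : (cos t)%:C = (expi t + expi (- t)) / 2.
Proof. by rewrite !expi_cos_sin cosN sinN rmorphN /=; field. Qed.

Lemma sin_expi (t : R) : (sin t)%:C = - 'i / 2 * (expi t - expi (- t)).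
Proof.
rewrite !expi_cos_sin cosN sinN rmorphN /=.
transitivity (- 'i ^+ 2 * (sin t)%:C : R[i]); last by field.
by rewrite sqr_i opprK mul1r.
Qed.

Lemma expcharD p q z : expchar (p + q) z = expchar p z * expchar q z.
Proof. by rewrite /expchar dotDl expiD. Qed.

Lemma expchar0 z : expchar 0 z = 1.
Proof. by rewrite /expchar dot0l expi0. Qed.

Lemma normc_expi (t : R) : Normc.normc (expi t) = 1.
Proof. by rewrite /expi /= cos2Dsin2 sqrtr1. Qed.

Lemma eval_tp_cat T T' z : eval_tp (T ++ T') z = eval_tp T z + eval_tp T' z.
Proof. by rewrite /eval_tp big_cat. Qed.

Lemma eval_tp_nil z : eval_tp [::] z = 0.
Proof. by rewrite /eval_tp big_nil. Qed.

Lemma eval_tp_cons t T z :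
  eval_tp (t :: T) z = t.2 * expchar t.1 z + eval_tp T z.
Proof. by rewrite /eval_tp big_cons. Qed.

Definition twist_tp (p : int * int) (c : R[i]) (T : seq ((int * int) * R[i])) :=
  [seq (t.1 + p, c * t.2) | t <- T].

Lemma eval_twist p c T z :
  eval_tp (twist_tp p c T) z = c * expchar p z * eval_tp T z.
Proof.
rewrite /eval_tp big_map mulr_sumr; apply: eq_bigr => t _ /=.
by rewrite expcharD; ring.
Qed.

Lemma freq_leD D D' p q : freq_le D p -> freq_le D' q -> freq_le (D + D') (p + q).
Proof.
move=> /andP[p1 p2] /andP[q1 q2]; apply/andP; split => /=; lia.
Qed.

Lemma trig_poly_le D D' f : (D <= D')%N -> trig_poly D f -> trig_poly D' f.
Proof.
move=> DD' [T hT fT]; exists T => //; apply: sub_all hT => t.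
by rewrite /freq_le => /andP[h1 h2]; rewrite !(leq_trans _ DD').
Qed.

Lemma eq_trig_poly D f g : f =1 g -> trig_poly D f -> trig_poly D g.
Proof. by move=> fg [T hT fT]; exists T => // z; rewrite -fg. Qed.

Lemma trig_polyD D f g : trig_poly D f -> trig_poly D g ->
  trig_poly D (fun z => f z + g z).
Proof.
move=> [T hT fT] [T' hT' gT']; exists (T ++ T') => [|z].
  by rewrite all_cat hT hT'.
by rewrite eval_tp_cat fT gT'.
Qed.

Lemma trig_poly_twist D D' p c f : trig_poly D f -> freq_le D' p ->
  trig_poly (D + D') (fun z => c * expchar p z * f z).
Proof.
move=> [T hT fT] hp; exists (twist_tp p c T) => [|z]; last first.
  by rewrite eval_twist fT.
by rewrite all_map; apply: sub_all hT => t /= ht; exact: freq_leD.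
Qed.

Lemma trig_poly0 D : trig_poly D (fun=> 0).
Proof. by exists [::] => // z; rewrite eval_tp_nil. Qed.

Lemma trig_polyM D D' f g : trig_poly D f -> trig_poly D' g ->
  trig_poly (D + D') (fun z => f z * g z).
Proof.
move=> [T hT fT] tg; suff h : trig_poly (D + D') (fun z => eval_tp T z * g z).
  by apply: eq_trig_poly h => z; rewrite fT.
elim: T hT {fT} => [_|t T IH /= /andP[ht hT]].
  by apply: eq_trig_poly (trig_poly0 _) => z; rewrite eval_tp_nil mul0r.
have := trig_polyD _ (IH hT).
move=> /(_ (fun z => t.2 * expchar t.1 z * g z)) h.
apply: eq_trig_poly (h _) => [z|]; first by rewrite eval_tp_cons mulrDl.
by rewrite addnC; exact: trig_poly_twist.
Qed.

Lemma trig_poly_cst c : trig_poly 0 (fun=> c).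
Proof.
exists [:: (0, c)] => // z.
by rewrite eval_tp_cons eval_tp_nil expchar0 mulr1 addr0.
Qed.

Lemma trig_polyZ D c f : trig_poly D f -> trig_poly D (fun z => c * f z).
Proof. exact: trig_polyM (trig_poly_cst c). Qed.

Lemma trig_poly_expchar D p : freq_le D p -> trig_poly D (expchar p).
Proof.
move=> hp; exists [:: (p, 1)] => [|z]; first by rewrite /= hp.
by rewrite eval_tp_cons eval_tp_nil mul1r addr0.
Qed.

Definition rtrig_poly D (f : R * R -> R) := trig_poly D (fun z => (f z)%:C).

Lemma rtrig_poly_le D D' f : (D <= D')%N -> rtrig_poly D f -> rtrig_poly D' f.
Proof. exact: trig_poly_le. Qed.

Lemma eq_rtrig_poly D f g : f =1 g -> rtrig_poly D f -> rtrig_poly D g.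
Proof. by move=> fg; apply: eq_trig_poly => z; rewrite fg. Qed.

Lemma rtrig_polyD D f g : rtrig_poly D f -> rtrig_poly D g ->
  rtrig_poly D (fun z => f z + g z).
Proof.
by move=> tf tg; apply: eq_trig_poly (trig_polyD tf tg) => z; rewrite rmorphD.
Qed.

Lemma rtrig_polyM D D' f g : rtrig_poly D f -> rtrig_poly D' g ->
  rtrig_poly (D + D') (fun z => f z * g z).
Proof.
by move=> tf tg; apply: eq_trig_poly (trig_polyM tf tg) => z; rewrite rmorphM.
Qed.

Lemma rtrig_poly_cst D c : rtrig_poly D (fun=> c).
Proof. exact: trig_poly_le (leq0n _) (trig_poly_cst _). Qed.

Lemma rtrig_polyZ D c f : rtrig_poly D f -> rtrig_poly D (fun z => c * f z).
Proof. exact: rtrig_polyM (rtrig_poly_cst 0 c). Qed.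

Lemma rtrig_polyB D f g : rtrig_poly D f -> rtrig_poly D g ->
  rtrig_poly D (fun z => f z - g z).
Proof.
move=> tf tg; apply: eq_rtrig_poly (rtrig_polyD tf (rtrig_polyZ (-1) tg)) => z.
by rewrite mulN1r.
Qed.

Lemma rtrig_polyX D f k : rtrig_poly D f -> rtrig_poly (k * D) (fun z => f z ^+ k).
Proof.
move=> tf; elim: k => [|k IH].
  by apply: eq_rtrig_poly (rtrig_poly_cst _ 1) => z; rewrite expr0.
by apply: eq_rtrig_poly (rtrig_polyM tf IH) => z; rewrite exprS.
Qed.

Lemma rtrig_poly_sum D (I : Type) (r : seq I) (P : pred I) (f : I -> R * R -> R) :
  (forall i, P i -> rtrig_poly D (f i)) ->
  rtrig_poly D (fun z => \sum_(i <- r | P i) f i z).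
Proof.
move=> tf; elim: r => [|i r IH].
  by apply: eq_rtrig_poly (rtrig_poly_cst _ 0) => z; rewrite big_nil.
have [Pi|Pi] := boolP (P i).
  by apply: eq_rtrig_poly (rtrig_polyD (tf i Pi) IH) => z; rewrite big_cons Pi.
by apply: eq_rtrig_poly IH => z; rewrite big_cons (negbTE Pi).
Qed.

Lemma freq_leN D p : freq_le D (- p) = freq_le D p.
Proof. by rewrite /freq_le /= !abszN. Qed.

Lemma rtrig_poly_cos D p : freq_le D p -> rtrig_poly D (fun z => cos (dot p z)).
Proof.
move=> hp; have hN : freq_le D (- p) by rewrite freq_leN.
have := trig_polyZ 2^-1
  (trig_polyD (trig_poly_expchar hp) (trig_poly_expchar hN)).
by apply: eq_trig_poly => z; rewrite cos_expi mulrC /expchar dotNl.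
Qed.

Lemma rtrig_poly_sin D p : freq_le D p -> rtrig_poly D (fun z => sin (dot p z)).
Proof.
move=> hp; have hN : freq_le D (- p) by rewrite freq_leN.
have := trig_polyZ (- 'i / 2) (trig_polyD (trig_poly_expchar hp)
  (trig_polyZ (-1) (trig_poly_expchar hN))).
by apply: eq_trig_poly => z; rewrite sin_expi mulN1r /expchar dotNl.
Qed.

End TrigonometricPolynomials.

(** * Integration over the torus and Fourier coefficients *)

Section TorusIntegral.
Context {R : realType}.
Implicit Types (p q : int * int) (z : R * R) (D : nat) (f g h : R * R -> R).
Local Notation mu := (@lebesgue2 R).
Local Notation leb := (@lebesgue_measure R).
Local Notation I := (`[(0 : R), pi *+ 2[%classic).

Local Notation T2 := (measurableTypeR R * measurableTypeR R)%type.

Lemma twopi_gt0 : 0 < pi *+ 2 :> R.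
Proof. by rewrite pmulrn_lgt0 ?pi_gt0. Qed.

Lemma measurable_torus : measurable (torus : set T2).
Proof. by apply: measurableX; exact: measurable_itv. Qed.

Lemma lebesgue_circle : leb I = (pi *+ 2)%:E.
Proof. by rewrite lebesgue_measure_itv /= lte_fin twopi_gt0 oppr0 adde0. Qed.

Lemma lebesgue2_torus : mu torus = ((pi *+ 2) ^+ 2)%:E.
Proof.
apply: etrans (product_measure1E _ _ _ _) _; [exact: measurable_itv..|].
by rewrite expr2 EFinM -lebesgue_circle.
Qed.

Definition bounded_measurable f :=
  measurable_fun (setT : set T2) f /\ exists M, forall z, `|f z| <= M.

Lemma bounded_measurable_cst c : bounded_measurable (fun=> c).
Proof. by split => //; exists `|c|. Qed.

Lemma bounded_measurableD f g : bounded_measurable f -> bounded_measurable g ->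
  bounded_measurable (fun z => f z + g z).
Proof.
move=> [mf [M fM]] [mg [N gN]]; split; first exact: measurable_funD.
by exists (M + N) => z; rewrite (le_trans (ler_normD _ _))// lerD.
Qed.

Lemma bounded_measurableM f g : bounded_measurable f -> bounded_measurable g ->
  bounded_measurable (fun z => f z * g z).
Proof.
move=> [mf [M fM]] [mg [N gN]]; split; first exact: measurable_funM.
by exists (M * N) => z; rewrite normrM ler_pM.
Qed.

Lemma integrable_torus f : bounded_measurable f ->
  mu.-integrable torus (EFin \o f).
Proof.
move=> [mf [M fM]]; apply: measurable_bounded_integrable.
- exact: measurable_torus.
- by rewrite [X in (X < _)%E]lebesgue2_torus ltry.
- exact: measurable_funS mf.
- exists M; split => [|y yM z _]; first exact: num_real.
  exact: le_trans (fM z) (ltW yM).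
Qed.

Lemma measurable_dot p : measurable_fun (setT : set T2) (@dot R p).
Proof.
by apply: measurable_funD; apply: measurable_funM.
Qed.

Lemma bounded_measurable_cos p : bounded_measurable (fun z => cos (dot p z)).
Proof.
split; last by exists 1 => z; exact: cos_max.
apply: measurableT_comp (measurable_dot p).
by apply: continuous_measurable_fun; exact: continuous_cos.
Qed.

Lemma bounded_measurable_sin p : bounded_measurable (fun z => sin (dot p z)).
Proof.
split; last by exists 1 => z; exact: sin_max.
apply: measurableT_comp (measurable_dot p).
by apply: continuous_measurable_fun; exact: continuous_sin.
Qed.

Lemma Rintegral_torus_prod (g h : R -> R) :
  continuous g -> continuous h ->
  (exists M : R, forall x, `|g x| <= M) -> (exists M : R, forall x, `|h x| <= M) ->
  (\int[mu]_(z in torus) (g z.1 * h z.2) =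
   (\int[leb]_(x in I) g x) * (\int[leb]_(x in I) h x))%R.
Proof.
move=> cg ch [M gM] [N hN].
have mg : measurable_fun (setT : set (measurableTypeR R)) g by exact: continuous_measurable_fun.
have mh : measurable_fun (setT : set (measurableTypeR R)) h by exact: continuous_measurable_fun.
have bgh : bounded_measurable (fun z => g z.1 * h z.2).
  split; last by exists (M * N) => z; rewrite normrM ler_pM.
  by apply: measurable_funM; apply: measurableT_comp.
have igh := integrable_torus bgh.
have int1 (k : R -> R) (K : R) :
    measurable_fun (setT : set (measurableTypeR R)) k -> (forall x, `|k x| <= K) ->
    leb.-integrable I (EFin \o k).
  move=> mk kK; apply: measurable_bounded_integrable => //.
  - by rewrite [X in (X < _)%E]lebesgue_circle ltry.
  - exact: measurable_funS mk.
  - exists K; split => [|y yM x _]; first exact: num_real.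
    exact: le_trans (kK x) (ltW yM).
have ig := int1 _ _ mg gM.
have ih := int1 _ _ mh hN.
have igh' := (integrable_mkcond _ measurable_torus).1 igh.
have ih' : leb.-integrable setT ((fun y => (h y)%:E) \_ I).
  by apply: (integrable_mkcond _ _).1 => //; exact: measurable_itv.
have ig' : leb.-integrable setT ((fun y => (g y)%:E) \_ I).
  by apply: (integrable_mkcond _ _).1 => //; exact: measurable_itv.
have fg : (\int[leb]_(x in I) (g x)%:E)%E \is a fin_num.
  by apply: integrable_fin_num => //; exact: measurable_itv.
have fh : (\int[leb]_(x in I) (h x)%:E)%E \is a fin_num.
  by apply: integrable_fin_num => //; exact: measurable_itv.
rewrite /Rintegral -fineM//; congr fine.
(* Fubini is applied on the whole plane, to the integrand extended by zero off the torus. *)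
rewrite integral_mkcond /lebesgue2 -[LHS](integral12_prod_meas1 igh').
rewrite /fubini_F.
transitivity (\int[leb]_x (((fun x => (g x)%:E) \_ I) x *
    \int[leb]_(y in I) (h y)%:E))%E.
  apply: eq_integral => x _; rewrite [in RHS]integral_mkcond patchE.
  have -> : (if x \in I then (g x)%:E else 0%E) =
            (if x \in I then g x else 0)%:E by case: ifP.
  rewrite -integralZl//; apply: eq_integral => y _.
  rewrite !patchE in_setX /=.
  by case: ifP => [/andP[-> ->]|]; [|case: ifP; case: ifP] => //=;
     rewrite ?mule0 ?mul0e.
rewrite [X in _ = (X * _)%E]integral_mkcond.
by rewrite -(fineK fh) integralZr.
Qed.

Lemma Rintegral_circle (F f : R -> R) : continuous f ->
  (forall x : R, is_derive x (1 : R) F (f x)) ->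
  (\int[leb]_(x in I) f x = F (pi *+ 2) - F 0)%R.
Proof.
move=> cf dF.
have cF : continuous F.
  move=> x; apply: differentiable_continuous; apply/derivable1_diffP.
  exact: (@ex_derive _ _ _ _ _ _ _ (dF x)).
have icc : leb.-integrable `[0, pi *+ 2] (EFin \o f).
  apply: continuous_compact_integrable; first exact: segment_compact.
  exact: continuous_subspaceT.
(* The endpoint is a null set; adding it gives the closed interval of the fundamental theorem of
   calculus. *)
rewrite Rintegral_itv_bndo_bndc; last first.
  apply: integrableS icc; [exact: measurable_itv|exact: measurable_itv|].
  by move=> x /=; rewrite !in_itv/= => /andP[-> /ltW ->].
rewrite /Rintegral (@continuous_FTC2 _ f F) ?twopi_gt0//.
- exact: continuous_subspaceT.
- split; last 2 first.
  + by apply: cvg_at_right_filter; exact: cF.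
  + by apply: cvg_at_left_filter; exact: cF.
  by move=> x _; exact: (@ex_derive _ _ _ _ _ _ _ (dF x)).
- by move=> x _; rewrite derive1E (@derive_val _ _ _ _ _ _ _ (dF x)).
Qed.

Lemma continuous_cosM (a : R) : continuous (fun x => cos (a * x)).
Proof.
move=> x; apply: continuous_comp; last exact: continuous_cos.
exact: mulrl_continuous.
Qed.

Lemma continuous_sinM (a : R) : continuous (fun x => sin (a * x)).
Proof.
move=> x; apply: continuous_comp; last exact: continuous_sin.
exact: mulrl_continuous.
Qed.

Lemma cos_sin_int2pi (n : int) :
  cos (n%:~R * pi *+ 2 : R) = 1 /\ sin (n%:~R * pi *+ 2 : R) = 0.
Proof.
suff h (k : nat) : cos (k%:R * pi *+ 2 : R) = 1 /\ sin (k%:R * pi *+ 2 : R) = 0.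
  case: n => k; first exact: h.
  have [c s] := h k.+1.
  by rewrite NegzE mulrNz mulNr mulNrn cosN sinN c s oppr0.
rewrite mulr_natl -mulrnA mulnC mulrnA.
elim: k => [|k [c s]]; first by rewrite mulr0n cos0 sin0.
by rewrite mulrS addrC cosD2pi sinD2pi c s.
Qed.

Lemma Rintegral_circle_cos (n : int) :
  (\int[leb]_(x in I) cos (n%:~R * x) = (n == 0)%:R * (pi *+ 2))%R.
Proof.
have [->|n0] := eqVneq n 0.
  rewrite mul1r; apply: etrans (@Rintegral_circle id _ _ _) _.
  - exact: continuous_cosM.
  - by move=> x; rewrite mul0r cos0; exact: is_derive_id.
  - by rewrite subr0.
have n0' : n%:~R != 0 :> R by rewrite intr_eq0.
rewrite mul0r; apply: etrans
  (@Rintegral_circle (fun x => n%:~R^-1 * sin (n%:~R * x)) _ _ _) _.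
- exact: continuous_cosM.
- move=> x; apply: is_derive_eq.
  by rewrite /GRing.scale /= mulr1; field.
- by rewrite mulrnAr (cos_sin_int2pi n).2 !mulr0 sin0 mulr0 subr0.
Qed.

Lemma Rintegral_circle_sin (n : int) :
  (\int[leb]_(x in I) sin (n%:~R * x) = 0 :> R)%R.
Proof.
have [->|n0] := eqVneq n 0.
  under eq_Rintegral do rewrite mul0r sin0.
  by rewrite Rintegral_cst ?mul0r//; exact: measurable_itv.
have n0' : n%:~R != 0 :> R by rewrite intr_eq0.
apply: etrans
  (@Rintegral_circle (fun x => - n%:~R^-1 * cos (n%:~R * x)) _ _ _) _.
- exact: continuous_sinM.
- move=> x; apply: is_derive_eq.
  by rewrite /GRing.scale /= mulr1; field.
- by rewrite mulrnAr (cos_sin_int2pi n).1 !mulr0 cos0 subrr.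
Qed.

End TorusIntegral.

(** * Fourier coefficients of trigonometric polynomials *)

Section FourierCoefficients.
Context {R : realType}.
Implicit Types (p q : int * int) (z : R * R) (D : nat) (f g : R * R -> R[i]).
Local Notation mu := (@lebesgue2 R).

Lemma complex_ReM (a b : R[i]) :
  complex.Re (a * b) = complex.Re a * complex.Re b - complex.Im a * complex.Im b.
Proof. by case: a; case: b. Qed.

Lemma complex_ImM (a b : R[i]) :
  complex.Im (a * b) = complex.Re a * complex.Im b + complex.Im a * complex.Re b.
Proof. by case: a; case: b. Qed.

Lemma complex_ReD (a b : R[i]) : complex.Re (a + b) = complex.Re a + complex.Re b.
Proof. by case: a; case: b. Qed.

Lemma complex_ImD (a b : R[i]) : complex.Im (a + b) = complex.Im a + complex.Im b.
Proof. by case: a; case: b. Qed.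

Definition cbounded_measurable f :=
  bounded_measurable (fun z => complex.Re (f z)) /\
  bounded_measurable (fun z => complex.Im (f z)).

Lemma eq_bounded_measurable (f g : R * R -> R) :
  f =1 g -> bounded_measurable f -> bounded_measurable g.
Proof. by move=> /funext ->. Qed.

Lemma cbounded_measurableD f g : cbounded_measurable f ->
  cbounded_measurable g -> cbounded_measurable (fun z => f z + g z).
Proof.
move=> [fr fi] [gr gi]; split.
  by apply: eq_bounded_measurable (bounded_measurableD fr gr) => z; rewrite complex_ReD.
by apply: eq_bounded_measurable (bounded_measurableD fi gi) => z; rewrite complex_ImD.
Qed.

Lemma cbounded_measurable_cst (c : R[i]) : cbounded_measurable (fun=> c).
Proof. by split; exact: bounded_measurable_cst. Qed.

Lemma cbounded_measurableM f g : cbounded_measurable f ->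
  cbounded_measurable g -> cbounded_measurable (fun z => f z * g z).
Proof.
move=> [fr fi] [gr gi]; split; last first.
  by apply: eq_bounded_measurable (bounded_measurableD
    (bounded_measurableM fr gi) (bounded_measurableM fi gr)) => z; rewrite complex_ImM.
have h := bounded_measurableM (bounded_measurableM (bounded_measurable_cst (-1)) fi) gi.
apply: eq_bounded_measurable (bounded_measurableD (bounded_measurableM fr gr) h) => z.
by rewrite complex_ReM mulN1r mulNr.
Qed.

Lemma cbounded_measurable_expchar p : cbounded_measurable (expchar p : _ -> R[i]).
Proof. by split; [exact: bounded_measurable_cos|exact: bounded_measurable_sin]. Qed.

Lemma cbounded_measurable_eval T : cbounded_measurable (eval_tp T : _ -> R[i]).
Proof.
elim: T => [|t T IH].
  have -> : eval_tp [::] = fun _ : R * R => 0 :> R[i].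
    by apply/funext => z; rewrite eval_tp_nil.
  exact: cbounded_measurable_cst.
have -> : eval_tp (t :: T) = fun z : R * R => t.2 * expchar t.1 z + eval_tp T z.
  by apply/funext => z; rewrite eval_tp_cons.
apply: cbounded_measurableD IH; apply: cbounded_measurableM.
  exact: cbounded_measurable_cst.
exact: cbounded_measurable_expchar.
Qed.

Lemma cintegralD f g : cbounded_measurable f -> cbounded_measurable g ->
  cintegral torus (fun z => f z + g z) = cintegral torus f + cintegral torus g.
Proof.
move=> [/integrable_torus fr /integrable_torus fi].
move=> [/integrable_torus gr /integrable_torus gi].
rewrite /cintegral; simpc; congr (_ +i* _).
  rewrite -RintegralD//; last exact: measurable_torus.
  by apply: eq_Rintegral => z _; rewrite complex_ReD.
rewrite -RintegralD//; last exact: measurable_torus.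
by apply: eq_Rintegral => z _; rewrite complex_ImD.
Qed.

Lemma cintegralZ (c : R[i]) f : cbounded_measurable f ->
  cintegral torus (fun z => c * f z) = c * cintegral torus f.
Proof.
move=> [/integrable_torus fr /integrable_torus fi].
have mt := @measurable_torus R.
have h (a : R) (k : R * R -> R) : mu.-integrable torus (EFin \o k) ->
    mu.-integrable torus (EFin \o (fun z => a * k z)).
  by move=> ik; apply: eq_integrable (integrableZl mt a ik).
case: c => a b; rewrite /cintegral; simpc; congr (_ +i* _).
  rewrite -!RintegralZl// -RintegralB//; [|exact: h|exact: h].
  by apply: eq_Rintegral => z _; rewrite complex_ReM.
rewrite addrC -!RintegralZl// -RintegralD//; [|exact: h|exact: h].
by apply: eq_Rintegral => z _; rewrite complex_ImM addrC.
Qed.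

Lemma cintegral_expchar p :
  cintegral torus (expchar p : _ -> R[i]) = (p == 0)%:R * ((pi *+ 2) ^+ 2)%:C.
Proof.
have mt := @measurable_torus R.
have bcos (a : R) : exists M : R, forall x, `|cos (a * x)| <= M.
  by exists 1 => x; exact: cos_max.
have bsin (a : R) : exists M : R, forall x, `|sin (a * x)| <= M.
  by exists 1 => x; exact: sin_max.
have ip (u v : R -> R) : continuous u -> continuous v ->
  (exists M : R, forall x, `|u x| <= M) -> (exists M : R, forall x, `|v x| <= M) ->
  mu.-integrable torus (EFin \o (fun z => u z.1 * v z.2)).
  move=> cu cv [M uM] [N vN]; apply: integrable_torus; split.
    by apply: measurable_funM; apply: measurableT_comp => //;
      exact: continuous_measurable_fun.
  by exists (M * N) => z; rewrite normrM ler_pM.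
rewrite /cintegral /expchar /expi /dot /=.
under eq_Rintegral do rewrite cosD.
have [cc cs] := (@continuous_cosM R, @continuous_sinM R).
rewrite RintegralB//; last 2 first.
- by apply: (ip (fun x => cos (p.1%:~R * x)) (fun x => cos (p.2%:~R * x))).
- by apply: (ip (fun x => sin (p.1%:~R * x)) (fun x => sin (p.2%:~R * x))).
under [X in _ +i* X]eq_Rintegral do rewrite sinD.
rewrite RintegralD//; last 2 first.
- by apply: (ip (fun x => sin (p.1%:~R * x)) (fun x => cos (p.2%:~R * x))).
- by apply: (ip (fun x => cos (p.1%:~R * x)) (fun x => sin (p.2%:~R * x))).
rewrite (@Rintegral_torus_prod _ (fun x => cos (p.1%:~R * x)) (fun x => cos (p.2%:~R * x)))//.
rewrite (@Rintegral_torus_prod _ (fun x => sin (p.1%:~R * x)) (fun x => sin (p.2%:~R * x)))//.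
rewrite (@Rintegral_torus_prod _ (fun x => sin (p.1%:~R * x)) (fun x => cos (p.2%:~R * x)))//.
rewrite (@Rintegral_torus_prod _ (fun x => cos (p.1%:~R * x)) (fun x => sin (p.2%:~R * x)))//.
rewrite !Rintegral_circle_cos !Rintegral_circle_sin !(mul0r, mulr0, addr0, subr0).
have -> : (p == 0) = (p.1 == 0) && (p.2 == 0) by case: p.
by case: eqP; case: eqP; rewrite /= ?(mul0r, mulr0, mul1r, expr2).
Qed.

Lemma eq_fourier_coef f g n m : f =1 g -> fourier_coef f n m = fourier_coef g n m.
Proof. by move=> /funext ->. Qed.

Lemma fourier_coefD f g n m : cbounded_measurable f -> cbounded_measurable g ->
  fourier_coef (fun z => f z + g z) n m = fourier_coef f n m + fourier_coef g n m.
Proof.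
move=> bf bg; have be := cbounded_measurable_expchar (- (n, m)).
rewrite /fourier_coef -mulrDr; congr (_ * _).
have h k : cbounded_measurable k ->
  cbounded_measurable (fun z => k z * expi (- (n%:~R * z.1 + m%:~R * z.2))).
  move=> bk; have := cbounded_measurableM bk be.
  congr cbounded_measurable; apply/funext => z.
  by rewrite /expchar dotNl.
rewrite -cintegralD; [|exact: h|exact: h].
by congr cintegral; apply/funext => z; rewrite mulrDl.
Qed.

Lemma fourier_coefZ (c : R[i]) f n m : cbounded_measurable f ->
  fourier_coef (fun z => c * f z) n m = c * fourier_coef f n m.
Proof.
move=> bf; have be := cbounded_measurable_expchar (- (n, m)).
rewrite /fourier_coef mulrCA; congr (_ * _).
rewrite -cintegralZ.
  by congr cintegral; apply/funext => z; rewrite mulrA.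
have := cbounded_measurableM bf be.
congr cbounded_measurable; apply/funext => z.
by rewrite /expchar dotNl.
Qed.

Lemma fourier_coef_expchar p q :
  fourier_coef (expchar p : _ -> R[i]) q.1 q.2 = (p == q)%:R.
Proof.
rewrite /fourier_coef.
have -> : (fun z => expchar p z * expi (- (q.1%:~R * z.1 + q.2%:~R * z.2))) =
  expchar (p - q) :> (_ -> R[i]).
  by apply/funext => z; rewrite expcharD /expchar dotNl.
rewrite cintegral_expchar subr_eq0; case: eqP => _; rewrite ?mul0r ?mulr0//.
rewrite mul1r -rmorphM mulVf ?rmorph1//.
by rewrite expf_neq0// gt_eqF// twopi_gt0.
Qed.

Lemma fourier_coef0 n m : fourier_coef (fun=> 0 : R[i]) n m = 0.
Proof.
apply: etrans _ (etrans (fourier_coefZ 0 n m (cbounded_measurable_cst 0)) (mul0r _)).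
by apply: eq_fourier_coef => z; rewrite mul0r.
Qed.

Lemma fourier_coef_eval T q :
  fourier_coef (eval_tp T : _ -> R[i]) q.1 q.2 = \sum_(t <- T | t.1 == q) t.2.
Proof.
elim: T => [|t T IH].
  rewrite big_nil -(fourier_coef0 q.1 q.2).
  by apply: eq_fourier_coef => z; rewrite eval_tp_nil.
have -> : eval_tp (t :: T) = fun z : R * R => t.2 * expchar t.1 z + eval_tp T z.
  by apply/funext => z; rewrite eval_tp_cons.
have be := cbounded_measurable_expchar t.1.
rewrite fourier_coefD; [|apply: cbounded_measurableM => //|].
- rewrite fourier_coefZ// fourier_coef_expchar IH big_cons.
  by case: eqP; rewrite ?mulr1// mulr0 add0r.
- exact: cbounded_measurable_cst.
- exact: cbounded_measurable_eval.
Qed.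

End FourierCoefficients.

(** * Mean values and orthogonality *)

Section Mean.
Context {R : realType}.
Implicit Types (p q : int * int) (z : R * R) (D : nat) (f g : R * R -> R).
Local Notation mu := (@lebesgue2 R).

Definition mean f : R := (\int[mu]_(z in torus) f z)%R / (pi *+ 2) ^+ 2.

Lemma sqr_twopi_gt0 : 0 < (pi *+ 2 : R) ^+ 2.
Proof. by rewrite exprn_gt0 // twopi_gt0. Qed.

Lemma rtrig_poly_bounded_measurable D f : rtrig_poly D f -> bounded_measurable f.
Proof.
move=> [T _ fT]; apply: eq_bounded_measurable (cbounded_measurable_eval T).1.
by move=> z; rewrite -fT.
Qed.

Lemma meanD D f g : rtrig_poly D f -> rtrig_poly D g ->
  mean (fun z => f z + g z) = mean f + mean g.
Proof.
move=> tf tg; rewrite /mean -mulrDl; congr (_ / _); apply: RintegralD.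
- exact: measurable_torus.
- exact/integrable_torus/(rtrig_poly_bounded_measurable tf).
- exact/integrable_torus/(rtrig_poly_bounded_measurable tg).
Qed.

Lemma meanZ D (c : R) f : rtrig_poly D f -> mean (fun z => c * f z) = c * mean f.
Proof.
move=> tf; rewrite /mean mulrA; congr (_ / _); apply: RintegralZl.
- exact: measurable_torus.
- exact/integrable_torus/(rtrig_poly_bounded_measurable tf).
Qed.

Lemma mean_le D f g : rtrig_poly D f -> rtrig_poly D g ->
  (forall z, f z <= g z) -> mean f <= mean g.
Proof.
move=> tf tg fg; rewrite ler_pM2r ?invr_gt0 ?sqr_twopi_gt0//.
apply: le_Rintegral => //.
- exact: measurable_torus.
- exact/integrable_torus/(rtrig_poly_bounded_measurable tf).
- exact/integrable_torus/(rtrig_poly_bounded_measurable tg).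
Qed.

Lemma mean_cst (c : R) : mean (fun=> c) = c.
Proof.
rewrite /mean Rintegral_cst; last exact: measurable_torus.
rewrite [X in fine X]lebesgue2_torus /= mulfK//.
by rewrite gt_eqF// sqr_twopi_gt0.
Qed.

Lemma mean_sum D (I : Type) (r : seq I) (P : pred I) (f : I -> R * R -> R) :
  (forall i, P i -> rtrig_poly D (f i)) ->
  mean (fun z => \sum_(i <- r | P i) f i z) = \sum_(i <- r | P i) mean (f i).
Proof.
move=> tf; elim: r => [|i r IH].
  by rewrite big_nil; under eq_fun do rewrite big_nil; exact: mean_cst.
rewrite big_cons; under eq_fun do rewrite big_cons.
case: ifP => // Pi; rewrite -IH (meanD (tf _ Pi))//.
exact: rtrig_poly_sum.
Qed.

Lemma mean_fourier_coef f :
  (mean f)%:C = fourier_coef (fun z => (f z)%:C) 0 0.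
Proof.
rewrite /mean /fourier_coef mulrC rmorphM; congr (_ * _).
rewrite /cintegral -[LHS]complexr0; congr (_ +i* _).
  apply: eq_Rintegral => z _.
  by rewrite !mul0r addr0 oppr0 expi0 mulr1.
rewrite -[LHS](mul0r (fine (mu torus))) -Rintegral_cst; last exact: measurable_torus.
apply: eq_Rintegral => z _.
by rewrite !mul0r addr0 oppr0 expi0 mulr1.
Qed.

(** Frequency 0 occurs in the product only if [- q] is in the spectrum of [f], and the box that
    holds this spectrum is symmetric. *)
Lemma fourier_coef_orthogonal D (f : R * R -> R[i]) q :
  trig_poly D f -> ~~ freq_le D q ->
  fourier_coef (fun z => f z * expchar q z) 0 0 = 0.
Proof.
move=> [T hT fT] hq.
have -> : (fun z => f z * expchar q z) = eval_tp (twist_tp q 1 T).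
  by apply/funext => z; rewrite eval_twist fT mul1r mulrC.
rewrite (fourier_coef_eval _ (0, 0)) big_map big_seq_cond big1// => t /andP[tT /=].
rewrite addr_eq0 => /eqP tq.
by have := allP hT _ tT; rewrite tq freq_leN (negbTE hq).
Qed.

Lemma mean_orthogonal_cos D f q : rtrig_poly D f -> ~~ freq_le D q ->
  mean (fun z => f z * cos (dot q z)) = 0.
Proof.
move=> tf hq; apply: complexI; rewrite mean_fourier_coef rmorph0.
have hNq : ~~ freq_le D (- q) by rewrite freq_leN.
have cf : cbounded_measurable (fun z => (f z)%:C).
  by case: tf => T _ /funext ->; exact: cbounded_measurable_eval.
have cM p : cbounded_measurable (fun z => (f z)%:C * expchar p z).
  by apply: cbounded_measurableM cf _; exact: cbounded_measurable_expchar.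
have -> : (fun z => (f z * cos (dot q z))%:C) = (fun z =>
    2^-1 * ((f z)%:C * expchar q z + (f z)%:C * expchar (- q) z)).
  apply/funext => z; rewrite rmorphM /= cos_expi /expchar dotNl.
  by field.
rewrite fourier_coefZ; last exact: cbounded_measurableD.
by rewrite fourier_coefD// !(fourier_coef_orthogonal tf)// addr0 mulr0.
Qed.

Lemma fourier_coef_sum (I : Type) (r : seq I) (F : I -> R * R -> R[i]) n m :
  (forall i, cbounded_measurable (F i)) ->
  fourier_coef (fun z => \sum_(i <- r) F i z) n m =
  \sum_(i <- r) fourier_coef (F i) n m.
Proof.
move=> cF; suff [] : fourier_coef (fun z => \sum_(i <- r) F i z) n m =
    \sum_(i <- r) fourier_coef (F i) n m /\
  cbounded_measurable (fun z => \sum_(i <- r) F i z) by [].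
elim: r => [|i r [IH1 IH2]].
  rewrite big_nil; under eq_fun do rewrite big_nil.
  by split; [exact: fourier_coef0|exact: cbounded_measurable_cst].
rewrite big_cons; under eq_fun do rewrite big_cons.
split; last exact: cbounded_measurableD.
by rewrite fourier_coefD// IH1.
Qed.

(* The mean value of [cos ^+ N.*2]. *)
Definition central_ratio N : R := ('C(N.*2, N))%:R / 4 ^+ N.

Lemma freq_leMz D q (k : int) : k != 0 -> ~~ freq_le D q -> ~~ freq_le D (q *~ k).
Proof.
have E : q *~ k = (q.1 * k, q.2 * k).
  case: q => a b /=.
  have hp (m : nat) : (a, b) *+ m = (a * m%:Z, b * m%:Z).
    elim: m => [|m IH]; first by rewrite mulr0n !mulr0.
    by rewrite mulrS IH; congr pair => /=; lia.
  case: k => m; first exact: hp.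
  by rewrite NegzE mulrNz -[_ *~ _]/(_ *+ _) hp !mulrN.
by rewrite E /freq_le /=; nia.
Qed.

(** In the binomial expansion of the power, every term but the middle one carries a nonzero multiple
    of [q], hence is orthogonal to [f]. So [f] and the power of the cosine behave as independent
    variables. *)
Lemma mean_cos_even_power D f q N : rtrig_poly D f -> ~~ freq_le D q ->
  mean (fun z => f z * cos (dot q z) ^+ N.*2) = central_ratio N * mean f.
Proof.
move=> tf hq; apply: complexI; rewrite mean_fourier_coef rmorphM /= mean_fourier_coef.
have cf : cbounded_measurable (fun z => (f z)%:C).
  by case: tf => T _ /funext ->; exact: cbounded_measurable_eval.
pose w (i : 'I_N.*2.+1) : R[i] := ('C(N.*2, i))%:R / 4 ^+ N.
pose r (i : 'I_N.*2.+1) := q *~ (N%:Z *+ 2 - i%:Z *+ 2).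
have eX p k z : expchar p z ^+ k = expchar (p *+ k) z :> R[i].
  elim: k => [|k IH]; first by rewrite expr0 mulr0n expchar0.
  by rewrite exprS IH mulrS expcharD.
have -> : (fun z => (f z * cos (dot q z) ^+ N.*2)%:C) = (fun z =>
    \sum_(i < N.*2.+1) w i * ((f z)%:C * expchar (r i) z)).
  apply/funext => z; rewrite rmorphM rmorphXn /= cos_expi -dotNl -!/(expchar _ _).
  have p2 : 2 ^+ N.*2 = 4 ^+ N :> R[i].
    by rewrite -mul2n exprM; congr (_ ^+ N); rewrite expr2 -natrM.
  rewrite expr_div_n exprDn p2 mulr_suml mulr_sumr.
  apply: eq_bigr => i _; rewrite !eX.
  have -> : r i = q *+ (N.*2 - i) + (- q) *+ i.
    have iN := ltn_ord i.
    rewrite /r mulNrn !pmulrn -mulrNz -mulrzDr; congr (_ *~ _); lia.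
  by rewrite expcharD /w -[in LHS]mulr_natr; ring.
rewrite fourier_coef_sum => [|i]; last first.
  apply: cbounded_measurableM; first exact: cbounded_measurable_cst.
  apply: cbounded_measurableM => //; exact: cbounded_measurable_expchar.
have iN : (N < N.*2.+1)%N by lia.
rewrite (bigD1 (Ordinal iN))//= big1 => [|i iNN]; last first.
  rewrite fourier_coefZ; last first.
    apply: cbounded_measurableM => //; exact: cbounded_measurable_expchar.
  rewrite (fourier_coef_orthogonal tf) ?mulr0//.
  apply: freq_leMz hq; move: iNN; rewrite -val_eqE /=; lia.
rewrite addr0 fourier_coefZ; last first.
  apply: cbounded_measurableM => //; exact: cbounded_measurable_expchar.
congr (_ * _).
  by rewrite /w /central_ratio /= rmorphM fmorphV rmorphXn !rmorph_nat.
apply: eq_fourier_coef => z.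
by rewrite /r /= subrr mulr0z expchar0 mulr1.
Qed.

Lemma central_bin_rec N : ('C(N.+1.*2, N.+1) * N.+1 = 'C(N.*2, N) * (N.*2.+1).*2)%N.
Proof.
have h1 := mul_bin_diag (N.+1.*2) N.
have h2 := mul_bin_diag (N.*2.+1) N.
have h3 : 'C(N.*2.+1, N.+1) = 'C(N.*2.+1, N).
  by rewrite -bin_sub; [congr 'C(_, _); lia|lia].
rewrite doubleS /= in h1 h2 *; rewrite h3 in h2; nia.
Qed.

(** With the factor [2 N + 1] the induction closes, by [(2 N + 1) (2 N + 3) <= (2 N + 2) ^ 2]; with
    the factor [N] it would not. *)
Lemma central_bin_bound N : ((N.*2.+1) * 'C(N.*2, N) ^ 2 <= 16 ^ N)%N.
Proof.
elim: N => [//|N IH]; rewrite -(leq_pmul2r (_ : 0 < N.+1 ^ 2)%N) ?expn_gt0//.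
rewrite -mulnA -expnMn central_bin_rec expnMn (expnS 16 N).
set C2 := ('C(N.*2, N) ^ 2)%N in IH *.
apply: leq_trans (_ : 16 * (N.*2.+1 * C2) * N.+1 ^ 2 <= _)%N; last first.
  by rewrite leq_mul2r leq_mul2l IH orbT.
have : ((N.+1.*2.+1) * (N.*2.+1).*2 ^ 2 <= 16 * N.*2.+1 * N.+1 ^ 2)%N.
  rewrite !expnS !expn0; nia.
nia.
Qed.

Lemma central_ratio_bound N : N%:R * central_ratio N ^+ 2 <= 1.
Proof.
rewrite /central_ratio expr_div_n mulrA ler_pdivrMr ?exprn_gt0//.
rewrite mul1r -exprM mulnC exprM -natrX -natrM -!natrX ler_nat.
apply: leq_trans (central_bin_bound N).
by rewrite leq_mul2r; apply/orP; right; lia.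
Qed.

End Mean.

(** * The bounded polynomial attached to a binary tree of frequencies *)

Section SmoothSign.
Context {R : realType}.
Implicit Types (t : R) (k : nat).

(* Odd polynomials converging to the sign function on [-1, 1]: for
   [s' = s (3 - s^2) / 2] one has [1 - s'^2 = (1 - s^2)^2 (4 - s^2) / 4]. *)
Fixpoint smooth_sign k t : R :=
  if k is k'.+1 then smooth_sign k' t * (3 - smooth_sign k' t ^+ 2) / 2 else t.

Lemma smooth_sign_sqr k t : t ^+ 2 <= 1 ->
  0 <= 1 - smooth_sign k t ^+ 2 <= (1 - t ^+ 2) ^+ (2 ^ k).
Proof.
move=> t1; elim: k => [|k /andP[IH1 IH2]] /=.
  by rewrite expn0 expr1 subr_ge0 t1 lexx.
set x := smooth_sign k t in IH1 IH2 *.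
have E : 1 - (x * (3 - x ^+ 2) / 2) ^+ 2 =
  (1 - x ^+ 2) ^+ 2 * (4 - x ^+ 2) / 4 by field.
have xx := sqr_ge0 x.
rewrite E expnS mulnC exprM; apply/andP; split.
  by rewrite divr_ge0// mulr_ge0 ?sqr_ge0//; lra.
apply: le_trans (_ : (1 - x ^+ 2) ^+ 2 <= _).
  by rewrite ler_pdivrMr// ler_wpM2l ?sqr_ge0//; lra.
by rewrite lerXn2r// nnegrE// (le_trans IH1).
Qed.

Lemma smooth_sign_bound k t : t ^+ 2 <= 1 -> `|smooth_sign k t| <= 1.
Proof.
move=> /(smooth_sign_sqr k)/andP[h _].
by rewrite -(expr_le1 (ltn0Sn 1))// real_normK ?num_real// -subr_ge0.
Qed.

Lemma smooth_sign_le0 k t : t ^+ 2 <= 1 -> t <= 0 -> smooth_sign k t <= 0.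
Proof.
move=> t1 t0; elim: k => //= k IH.
have /andP[h _] := smooth_sign_sqr k t1.
rewrite mulr_le0_ge0 ?invr_ge0// mulr_le0_ge0//; lra.
Qed.

Lemma smooth_sign_ge0 k t : t ^+ 2 <= 1 -> 0 <= t -> 0 <= smooth_sign k t.
Proof.
move=> t1 t0; elim: k => //= k IH.
have /andP[h _] := smooth_sign_sqr k t1.
rewrite mulr_ge0 ?invr_ge0// mulr_ge0//; lra.
Qed.

Lemma rtrig_poly_smooth_sign D k (f : R * R -> R) : rtrig_poly D f ->
  rtrig_poly (3 ^ k * D) (fun z => smooth_sign k (f z)).
Proof.
move=> tf; elim: k => [|k IH]; first by rewrite mul1n.
have h := rtrig_polyX 2 IH.
have t3 := rtrig_polyB (rtrig_poly_cst _ 3) h.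
have := rtrig_polyZ 2^-1 (rtrig_polyM IH t3).
rewrite -mulSn mulnA -expnS; apply: eq_rtrig_poly => z /=.
by rewrite mulrC.
Qed.

Lemma sin_sqr_le1 (t : R) : sin t ^+ 2 <= 1.
Proof. by rewrite sin2cos2 gerBl sqr_ge0. Qed.

Lemma sum_expn_double j (f : nat -> R) :
  \sum_(i < 2 ^ j.+1) f i = \sum_(i < 2 ^ j) (f i.*2 + f i.*2.+1).
Proof.
rewrite expnS mul2n; elim: (2 ^ j)%N => [|m IH]; first by rewrite !big_ord0.
by rewrite doubleS !big_ord_recr /= IH addrA.
Qed.

End SmoothSign.

(** * The tree of frequencies and its bounded walk *)

Section Tree.
Context {R : realType} (n Q k : nat) (c : R).
Context (leQ : (2 ^ n <= Q)%N).
Context (c_ge0 : 0 <= c).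
Context (c_le : c <= 2^-1).
Implicit Types (i j l : nat) (z : R * R).

(* The children of node [(j, i)], [i < 2 ^ j], are [(j.+1, i.*2)] and
   [(j.+1, i.*2.+1)].  Leaf [l < 2 ^ n] lies below [(j, l %/ 2 ^ (n - j))], and,
   among the leaves below [(j, i)], those below the left child are the
   [l < split_point j i]. *)
Definition split_point j i := (i.*2.+1 * 2 ^ (n - j.+1))%N.

(** Common degree bound for [weight j], [walk j] and the increments of the levels before [j]. The
    factor [12 * degree j' + 2] is [magnitude j'], and [3 ^ k] is the degree of [smooth_sign k]. *)
Fixpoint degree j : nat :=
  if j is j'.+1 then
    4 * degree j' + 3 * (3 ^ k * ((12 * degree j' + 2) * (2 ^ n + Q)))
  else 0.

(** The 12 lets a node frequency outweigh, in every half-plane form, any frequency bounded by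
    [3 * degree j]. Orthogonality asks only for more than [4 * degree j]. *)
Definition magnitude j := (12 * degree j + 2)%N.

(** Orthogonal to [(1, s)] exactly for [s = split_point j i / Q]. The slopes [(2 l + 1) / (2 Q)]
    attached to the leaves are half-integers over [Q], so they lie strictly on one side of this
    value: below it for the leaves [l < split_point j i], above it for the others. *)
Definition node_freq j i : int * int :=
  (- (magnitude j * split_point j i)%:Z, (magnitude j * Q)%:Z).

Definition angle j i z : R := dot (node_freq j i) z.

(* Polynomial substitute for the indicator of the points [z] at which the signs
   of [sin (angle j' i' z)] at the ancestors of [(j, i)] dictate the path to
   [(j, i)]: positive means left. *)
Fixpoint weight j i z : R :=
  if j is j'.+1 then
    weight j' i./2 z * ((1 + (-1) ^+ odd i * smooth_sign k (sin (angle j' i./2 z))) / 2)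
  else 1.

Definition increment j z : R :=
  \sum_(i < 2 ^ j) weight j i z * cos (angle j i z).

(* The factor [1 - walk ^+ 2] keeps [walk] in [-1, 1] without truncation. *)
Fixpoint walk j z : R :=
  if j is j'.+1 then walk j' z + c * (1 - walk j' z ^+ 2) * increment j' z else 0.

Definition double_increment j z : R :=
  \sum_(i < 2 ^ j) weight j i z * cos (angle j i z *+ 2).

(** Polynomial lower bound for the weighted sum of the absolute values of the sines; by the double
    angle formula it oscillates about 1/2. *)
Definition variation j z : R :=
  \sum_(i < 2 ^ j) weight j i z * sin (angle j i z) ^+ 2.

(** The weights of a level are nonnegative with sum 1, so this vanishes exactly when [z] follows a
    single path. *)
Definition spread j z : R := 1 - \sum_(i < 2 ^ j) weight j i z ^+ 2.

Lemma smooth_sign_sin_bound (t : R) : -1 <= smooth_sign k (sin t) <= 1.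
Proof. by rewrite -ler_norml smooth_sign_bound ?sin_sqr_le1. Qed.

Lemma weight_ge0 j i z : 0 <= weight j i z.
Proof.
elim: j i => [|j IH] i //=; rewrite mulr_ge0//.
have /andP[h1 h2] := smooth_sign_sin_bound (angle j i./2 z).
by case: (odd i); rewrite ?expr1 ?expr0; lra.
Qed.

Lemma weight_double j i z : weight j.+1 i.*2 z =
  weight j i z * ((1 + smooth_sign k (sin (angle j i z))) / 2).
Proof. by rewrite /= odd_double doubleK expr0 mul1r. Qed.

Lemma weight_doubleS j i z : weight j.+1 i.*2.+1 z =
  weight j i z * ((1 - smooth_sign k (sin (angle j i z))) / 2).
Proof. by rewrite /= odd_double uphalf_double expr1 mulN1r. Qed.

Lemma weight_sum j z : \sum_(i < 2 ^ j) weight j i z = 1.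
Proof.
elim: j => [|j IH]; first by rewrite big_ord1.
rewrite (sum_expn_double _ (fun i => weight j.+1 i z)) -[RHS]IH.
by apply: eq_bigr => i _; rewrite weight_double weight_doubleS; field.
Qed.

Lemma weighted_bound j z (g : nat -> R) : (forall i, `|g i| <= 1) ->
  `|\sum_(i < 2 ^ j) weight j i z * g i| <= 1.
Proof.
move=> g1; rewrite -(weight_sum j z); apply: le_trans (ler_norm_sum _ _ _) _.
apply: ler_sum => i _; rewrite normrM ger0_norm ?weight_ge0//.
by rewrite ler_piMr ?weight_ge0.
Qed.

Lemma increment_bound j z : `|increment j z| <= 1.
Proof.
by apply: (@weighted_bound _ _ (fun i => cos (angle j i z))) => i; exact: cos_max.
Qed.

Lemma double_increment_bound j z : `|double_increment j z| <= 1.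
Proof.
by apply: (@weighted_bound _ _ (fun i => cos (angle j i z *+ 2))) => i; exact: cos_max.
Qed.

Lemma variation_double j z : variation j z = (1 - double_increment j z) / 2.
Proof.
rewrite -[X in X - _](weight_sum j z) /variation /double_increment -sumrB mulr_suml.
by apply: eq_bigr => i _; rewrite mulr2n cosD -!expr2 cos2sin2; field.
Qed.

(** From position [x] a step has size at most [(1 - x ^ 2) / 2], as [c <= 1/2], and this is at most
    the distance [1 - |x|] to the boundary. *)
Lemma walk_bound j z : `|walk j z| <= 1.
Proof.
elim: j => [|j] /=; first by rewrite normr0.
rewrite !ler_norml => /andP[h1 h2].
have := increment_bound j z; rewrite ler_norml => /andP[g1 g2].
move: (walk j z) (increment j z) h1 h2 g1 g2 => x g h1 h2 g1 g2.
have e : 0 <= 1 - x ^+ 2 by nra.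
have d : `|c * (1 - x ^+ 2) * g| <= (1 - x ^+ 2) / 2.
  rewrite normrM (ger0_norm (mulr_ge0 c_ge0 e)).
  have g0 : `|g| <= 1 by rewrite ler_norml g1.
  rewrite -[leLHS]mulrA [leLHS]mulrC -mulrA ler_wpM2l//.
  by rewrite -[leRHS]mul1r ler_pM.
move: d; rewrite ler_norml => /andP[d1 d2]; apply/andP.
have s1 := sqr_ge0 (1 - x); have s2 := sqr_ge0 (1 + x).
by rewrite sqrrB in s1; rewrite sqrrD in s2; split; lra.
Qed.

Lemma walk_sqr j z : 0 <= walk j z ^+ 2 <= 1.
Proof.
by rewrite sqr_ge0 -(real_normK (num_real _)) expr_le1// walk_bound.
Qed.

Lemma split_point_le j i : (j < n)%N -> (i < 2 ^ j)%N -> (split_point j i <= 2 ^ n)%N.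
Proof.
move=> jn ij; rewrite -[in leqRHS](subnKC jn) expnD leq_mul2r; apply/orP; right.
by rewrite expnS; lia.
Qed.

Lemma node_freq_le j i : (j < n)%N -> (i < 2 ^ j)%N ->
  freq_le (magnitude j * (2 ^ n + Q)) (node_freq j i).
Proof.
move=> jn ij; rewrite /freq_le /= abszN /=.
have h := split_point_le jn ij.
by rewrite !leq_mul2l (leq_trans h) ?leq_addr// leq_addl !orbT.
Qed.

Lemma node_freq_gt D j i m : (0 < m)%N -> (D < magnitude j)%N ->
  ~~ freq_le D (node_freq j i *+ m).
Proof.
move=> m0 Dj; rewrite pmulrn; apply: freq_leMz; first by rewrite -lt0n in m0 *; lia.
rewrite /freq_le /= negb_and; apply/orP; right.
have Q0 : (0 < Q)%N by apply: leq_trans leQ; rewrite expn_gt0.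
by rewrite -ltnNge (leq_trans Dj)// leq_pmulr.
Qed.

Lemma degree_leS j : (4 * degree j <= degree j.+1)%N.
Proof. exact: leq_addr. Qed.

Lemma degree_le i j : (i <= j)%N -> (degree i <= degree j)%N.
Proof.
move=> /subnKC <-; elim: (j - i)%N => [|m IH]; first by rewrite addn0.
by rewrite addnS; have := degree_leS (i + m); lia.
Qed.

Lemma degreeS_ge j : (4 * degree j + 3 * (magnitude j * (2 ^ n + Q)) <= degree j.+1)%N.
Proof. by rewrite leq_add2l leq_mul2l/= leq_pmull// expn_gt0. Qed.

Lemma degreeS_ge3k j :
  (4 * degree j + 3 ^ k * (magnitude j * (2 ^ n + Q)) <= degree j.+1)%N.
Proof. by rewrite leq_add2l leq_pmull. Qed.

Lemma rtrig_poly_weight j i : (j <= n)%N -> (i < 2 ^ j)%N ->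
  rtrig_poly (degree j) (weight j i).
Proof.
elim: j i => [|j IH] i jn ij; first exact: rtrig_poly_cst.
have ij2 : (i./2 < 2 ^ j)%N by move: ij; rewrite expnS; lia.
have tw := IH i./2 (ltnW jn) ij2.
have ts := rtrig_poly_smooth_sign k (@rtrig_poly_sin R _ _ (node_freq_le jn ij2)).
have tb := rtrig_polyZ 2^-1
  (rtrig_polyD (rtrig_poly_cst _ 1) (rtrig_polyZ ((-1) ^+ odd i) ts)).
apply: rtrig_poly_le (eq_rtrig_poly _ (rtrig_polyM tw tb)).
  by have := degreeS_ge3k j; lia.
by move=> z /=; rewrite [in RHS](mulrC _ 2^-1).
Qed.

Lemma rtrig_poly_angle_cos D j i m (g : R * R -> R) : (j < n)%N -> (i < 2 ^ j)%N ->
  rtrig_poly D g ->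
  rtrig_poly (D + m * (magnitude j * (2 ^ n + Q))) (fun z => g z * cos (angle j i z *+ m)).
Proof.
move=> jn ij tg; apply: rtrig_polyM tg _.
have hm : freq_le (m * (magnitude j * (2 ^ n + Q))) (node_freq j i *+ m).
  elim: m => [|m IH]; first by rewrite mulr0n.
  by rewrite mulrS mulSn; apply: freq_leD => //; exact: node_freq_le.
by apply: eq_rtrig_poly (@rtrig_poly_cos R _ _ hm) => z; rewrite dotMnl.
Qed.

Lemma rtrig_poly_increment j : (j < n)%N ->
  rtrig_poly (degree j + magnitude j * (2 ^ n + Q)) (increment j).
Proof.
move=> jn; apply: rtrig_poly_sum => i _.
have := rtrig_poly_angle_cos 1 jn (ltn_ord i) (rtrig_poly_weight (ltnW jn) (ltn_ord i)).
by rewrite mul1n; apply: eq_rtrig_poly => z; rewrite mulr1n.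
Qed.

Lemma rtrig_poly_double_increment j : (j < n)%N ->
  rtrig_poly (degree j + 2 * (magnitude j * (2 ^ n + Q))) (double_increment j).
Proof.
move=> jn; apply: rtrig_poly_sum => i _.
exact: (rtrig_poly_angle_cos 2 jn (ltn_ord i) (rtrig_poly_weight (ltnW jn) (ltn_ord i))).
Qed.

Lemma rtrig_poly_walk j : (j <= n)%N -> rtrig_poly (degree j) (walk j).
Proof.
elim: j => [|j IH] jn; first exact: rtrig_poly_cst.
have tF := IH (ltnW jn).
have tq := rtrig_polyZ c (rtrig_polyB (rtrig_poly_cst _ 1) (rtrig_polyX 2 tF)).
have tG := rtrig_polyM tq (rtrig_poly_increment jn).
have h := degreeS_ge j.
apply: rtrig_polyD; first by apply: rtrig_poly_le tF; lia.
by apply: rtrig_poly_le tG; lia.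
Qed.

(** * Mean values along the tree *)

Lemma mean_node_orthogonal D j m (g : nat -> R * R -> R) :
  (0 < m)%N -> (j < n)%N -> (D < magnitude j)%N ->
  (forall i, (i < 2 ^ j)%N -> rtrig_poly D (g i)) ->
  mean (fun z => \sum_(i < 2 ^ j) g i z * cos (angle j i z *+ m)) = 0.
Proof.
move=> m0 jn Dj tg.
rewrite (mean_sum (D := D + m * (magnitude j * (2 ^ n + Q)))); last first.
  by move=> i _; apply: rtrig_poly_angle_cos => //; exact: tg.
apply: big1 => i _.
rewrite -[RHS](mean_orthogonal_cos (tg i (ltn_ord i)) (node_freq_gt i m0 Dj)).
by congr mean; apply/funext => z; rewrite dotMnl.
Qed.

(** Expanding the square at [j.+1] gives a cross term and a square at most [c ^ 2]. The coefficients
    of the cross term have degree at most [4 * degree j], below [magnitude j], so its mean is 0.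
    This shows that the damping factor [1 - walk ^ 2] is usually close to 1. *)
Lemma mean_walk_sqr j : (j <= n)%N -> mean (fun z => walk j z ^+ 2) <= j%:R * c ^+ 2.
Proof.
elim: j => [|j IH] jn.
  by under eq_fun do rewrite /= expr0n; rewrite mean_cst mul0r.
have h := degreeS_ge j.
have tF := rtrig_poly_walk (ltnW jn).
have tF2 := rtrig_polyX 2 tF.
have tq := rtrig_polyM (rtrig_polyZ (2 * c) tF) (rtrig_polyB (rtrig_poly_cst _ 1) tF2).
pose g i z := 2 * c * walk j z * (1 - walk j z ^+ 2) * weight j i z.
have tg i : (i < 2 ^ j)%N -> rtrig_poly (4 * degree j) (g i).
  move=> ij; apply: rtrig_poly_le (rtrig_polyM tq (rtrig_poly_weight (ltnW jn) ij)).
  lia.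
pose X z := \sum_(i < 2 ^ j) g i z * cos (angle j i z *+ 1).
have tX : rtrig_poly (2 * degree j.+1) X.
  apply: rtrig_poly_sum => i _.
  by apply: rtrig_poly_le (rtrig_poly_angle_cos 1 jn (ltn_ord i) (tg i (ltn_ord i))); lia.
have X0 : mean X = 0.
  by apply: (mean_node_orthogonal (D := 4 * degree j)) => //; rewrite /magnitude; lia.
have tF2' : rtrig_poly (2 * degree j.+1) (fun z => walk j z ^+ 2).
  by apply: rtrig_poly_le tF2; lia.
have tFX := rtrig_polyD tF2' tX.
apply: le_trans (_ : mean (fun z => walk j z ^+ 2 + X z + c ^+ 2) <= _).
  apply: (mean_le (D := 2 * degree j.+1)).
  - exact/(rtrig_polyX 2)/rtrig_poly_walk.
  - by apply: rtrig_polyD tFX _; exact: rtrig_poly_cst.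
  move=> z.
  have -> : X z = 2 * c * walk j z * (1 - walk j z ^+ 2) * increment j z.
    rewrite mulr_sumr; apply: eq_bigr => i _.
    by rewrite mulr1n mulrA.
  have /andP[w0 w1] := walk_sqr j z.
  have := increment_bound j z; rewrite -(expr_le1 (ltn0Sn 1))// real_normK ?num_real// => G1.
  have G0 := sqr_ge0 (increment j z).
  have c2 := sqr_ge0 c.
  rewrite /= -subr_ge0.
  have -> : walk j z ^+ 2 + 2 * c * walk j z * (1 - walk j z ^+ 2) * increment j z +
    c ^+ 2 - (walk j z + c * (1 - walk j z ^+ 2) * increment j z) ^+ 2 =
    c ^+ 2 * (1 - (1 - walk j z ^+ 2) ^+ 2 * increment j z ^+ 2) by ring.
  by rewrite mulr_ge0// subr_ge0 mulr_ile1 ?sqr_ge0// exprn_ile1//; lra.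
rewrite (meanD tFX (rtrig_poly_cst _ _)) (meanD tF2' tX) X0 mean_cst addr0.
by rewrite -natr1 mulrDl mul1r lerD2r IH// ltnW.
Qed.

(** The levels are orthogonal and each is bounded by 1, so the mean square grows linearly: for most
    points the variations add up to about [j / 2]. *)
Lemma mean_double_increment_sqr j : (j <= n)%N ->
  mean (fun z => (\sum_(i < j) double_increment i z) ^+ 2) <= j%:R.
Proof.
elim: j => [|j IH] jn.
  by under eq_fun do rewrite big_ord0 expr0n; rewrite mean_cst.
have h := degreeS_ge j.
pose T z := \sum_(i < j) double_increment i z.
have tT : rtrig_poly (degree j) T.
  apply: rtrig_poly_sum => i _.
  apply: rtrig_poly_le (rtrig_poly_double_increment (ltn_trans (ltn_ord i) jn)).
  by have := degreeS_ge i; have := degree_le (ltn_ord i); lia.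
have tT2 := rtrig_polyX 2 tT.
pose g i z := 2 * T z * weight j i z.
have tg i : (i < 2 ^ j)%N -> rtrig_poly (4 * degree j) (g i).
  move=> ij; apply: rtrig_poly_le
    (rtrig_polyM (rtrig_polyZ 2 tT) (rtrig_poly_weight (ltnW jn) ij)).
  lia.
pose X z := \sum_(i < 2 ^ j) g i z * cos (angle j i z *+ 2).
have tX : rtrig_poly (2 * degree j.+1) X.
  apply: rtrig_poly_sum => i _.
  by apply: rtrig_poly_le (rtrig_poly_angle_cos 2 jn (ltn_ord i) (tg i (ltn_ord i))); lia.
have X0 : mean X = 0.
  by apply: (mean_node_orthogonal (D := 4 * degree j)) => //; rewrite /magnitude; lia.
have tT2' : rtrig_poly (2 * degree j.+1) (fun z => T z ^+ 2).
  by apply: rtrig_poly_le tT2; lia.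
have tTX := rtrig_polyD tT2' tX.
apply: le_trans (_ : mean (fun z => T z ^+ 2 + X z + 1) <= _).
  apply: (mean_le (D := 2 * degree j.+1)).
  - apply: (rtrig_polyX 2); under eq_fun do rewrite big_ord_recr /=.
    apply: rtrig_polyD; first by apply: rtrig_poly_le tT; lia.
    by apply: rtrig_poly_le (rtrig_poly_double_increment jn); lia.
  - by apply: rtrig_polyD tTX _; exact: rtrig_poly_cst.
  move=> z; rewrite big_ord_recr /= -/(T z).
  have -> : X z = 2 * T z * double_increment j z.
    by rewrite mulr_sumr; apply: eq_bigr => i _; rewrite mulrA.
  have := double_increment_bound j z.
  rewrite -(expr_le1 (ltn0Sn 1))// real_normK ?num_real// => D1.
  by rewrite sqrrD; lra.
rewrite (meanD tTX (rtrig_poly_cst _ _)) (meanD tT2' tX) X0 mean_cst addr0.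
by rewrite -natr1 lerD2r IH// ltnW.
Qed.

Lemma rtrig_poly_spread j : (j <= n)%N -> rtrig_poly (2 * degree j) (spread j).
Proof.
move=> jn; apply: rtrig_polyB; first exact: rtrig_poly_cst.
apply: rtrig_poly_sum => i _; apply: rtrig_polyX.
exact: rtrig_poly_weight.
Qed.

(** Splitting [w] in the proportions [(1 + x) / 2] and [(1 - x) / 2] turns [w ^ 2] into
    [w ^ 2 (1 + x ^ 2) / 2], a loss of at most [w (1 - x ^ 2)]. By [smooth_sign_sqr] this is at most
    [w] times the power [2 * 2 ^ k] of a cosine. Since the weights sum to 1, a level costs
    [central_ratio (2 ^ k)] on average. *)
Lemma mean_spread j : (j <= n)%N -> mean (spread j) <= j%:R * central_ratio (2 ^ k).
Proof.
elim: j => [|j IH] jn.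
  rewrite mul0r; have -> : spread 0 = fun=> 0.
    by apply/funext => z; rewrite /spread big_ord1 expr1n subrr.
  by rewrite mean_cst.
pose N := (2 ^ k)%N.
pose X z := \sum_(i < 2 ^ j) weight j i z * cos (angle j i z) ^+ N.*2.
pose D := (2 * degree j.+1 + degree j.+1 + N.*2 * (magnitude j * (2 ^ n + Q)))%N.
have tXi (i : 'I_(2 ^ j)) : rtrig_poly D (fun z => weight j i z * cos (angle j i z) ^+ N.*2).
  have tc := rtrig_polyX N.*2 (@rtrig_poly_cos R _ _ (node_freq_le jn (ltn_ord i))).
  apply: rtrig_poly_le (rtrig_polyM (rtrig_poly_weight (ltnW jn) (ltn_ord i)) tc).
  by rewrite /D; have := degreeS_ge j; lia.
have tX : rtrig_poly D X by apply: rtrig_poly_sum => i _; exact: tXi.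
have mX : mean X = central_ratio N.
  rewrite (mean_sum (D := D)); last by move=> i _; exact: tXi.
  under eq_bigr => i _.
    have hi : ~~ freq_le (degree j) (node_freq j i).
      rewrite -[node_freq j i]mulr1n; apply: node_freq_gt => //.
      by rewrite /magnitude; lia.
    rewrite (mean_cos_even_power _ (rtrig_poly_weight (ltnW jn) (ltn_ord i)) hi).
    over.
  rewrite -mulr_sumr -(mean_sum (D := degree j)) => [|i _]; last first.
    exact: rtrig_poly_weight (ltnW jn) (ltn_ord i).
  by under eq_fun do rewrite weight_sum; rewrite mean_cst mulr1.
have ts : rtrig_poly D (spread j).
  by apply: rtrig_poly_le (rtrig_poly_spread (ltnW jn)); have := degreeS_ge j; rewrite /D; lia.
apply: le_trans (_ : mean (fun z => spread j z + X z) <= _).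
  apply: (mean_le (D := D)).
  - by apply: rtrig_poly_le (rtrig_poly_spread jn); rewrite /D; lia.
  - exact: rtrig_polyD.
  move=> z; rewrite /spread -addrA lerD2l lerNl opprD opprK lerBlDr.
  rewrite (sum_expn_double _ (fun i => weight j.+1 i z ^+ 2)) -big_split.
  apply: ler_sum => i _; rewrite weight_double weight_doubleS.
  have /andP[h1 h2] := smooth_sign_sqr k (sin_sqr_le1 (angle j i z)).
  rewrite -cos2sin2 -exprM in h2.
  have w0 := weight_ge0 j i z.
  have w1 : weight j i z <= 1.
    rewrite -(weight_sum j z) (bigD1 i)//= lerDl sumr_ge0// => l _.
    exact: weight_ge0.
  move: (smooth_sign k _) h1 h2 => x h1 h2; rewrite -/N in h2.
  set w := weight j i z in w0 w1 *.
  have : w ^+ 2 * (1 - x ^+ 2) <= w * cos (angle j i z) ^+ (2 * N).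
    rewrite expr2 -mulrA ler_wpM2l//; apply: le_trans h2.
    by rewrite ler_piMl.
  have : 0 <= w ^+ 2 * (1 - x ^+ 2) by rewrite mulr_ge0 ?sqr_ge0.
  rewrite -mul2n => a1 a2; rewrite -subr_ge0.
  have -> : (w * ((1 + x) / 2)) ^+ 2 + (w * ((1 - x) / 2)) ^+ 2 +
     w * cos (angle j i z) ^+ (2 * N) - w ^+ 2 =
     w * cos (angle j i z) ^+ (2 * N) - w ^+ 2 * (1 - x ^+ 2) / 2 by field.
  lra.
rewrite (meanD ts tX) mX -natr1 mulrDl mul1r lerD2r.
exact: IH (ltnW jn).
Qed.

(* [2 Q (p.1 + s p.2)] for the slope [s = (2 l + 1) / (2 Q)].  At
   [node_freq j i] it equals [magnitude j * Q * (2 l + 1 - 2 split_point j i)],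
   so which of the two frequencies [+- node_freq j i] belongs to the half-plane
   where the form is negative tells on which side of the node leaf [l] is. *)
Definition half_plane_form l (p : int * int) : int :=
  p.1 * (2 * Q)%:Z + (2 * l + 1)%:Z * p.2.

(** One list [T] serves all leaves [l] at once, and [S l] is the half-plane sum for leaf [l]. That
    no frequency lies on a boundary line is what allows discs to replace half-planes. *)
Definition splits D (f : R * R -> R[i]) (S : nat -> R * R -> R[i]) :=
  exists T, [/\ all (fun t => freq_le D t.1) T,
    forall l, (l < 2 ^ n)%N -> all (fun t => half_plane_form l t.1 != 0) T,
    f =1 eval_tp T &
    forall l, (l < 2 ^ n)%N ->
      S l =1 eval_tp [seq t <- T | half_plane_form l t.1 < 0]].

Lemma eq_splits D f g S S' : f =1 g ->
  (forall l, (l < 2 ^ n)%N -> S l =1 S' l) -> splits D f S -> splits D g S'.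
Proof.
move=> fg SS [T [hD h0 fT ST]]; exists T; split => // [z|l ln z].
  by rewrite -fg.
by rewrite -SS// ST.
Qed.

Lemma splits_le D D' f S : (D <= D')%N -> splits D f S -> splits D' f S.
Proof.
move=> DD [T [hD h0 fT ST]]; exists T; split => //.
apply: sub_all hD => t.
by rewrite /freq_le => /andP[h1 h2]; rewrite !(leq_trans _ DD).
Qed.

Lemma splits0 D : splits D (fun=> 0) (fun _ _ => 0).
Proof. by exists [::]; split => // [z|l _ z]; rewrite eval_tp_nil. Qed.

Lemma splitsD D f S g S' : splits D f S -> splits D g S' ->
  splits D (fun z => f z + g z) (fun l z => S l z + S' l z).
Proof.
move=> [T [hD h0 fT ST]] [T' [hD' h0' gT' ST']]; exists (T ++ T'); split.
- by rewrite all_cat hD.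
- by move=> l ln; rewrite all_cat h0 ?h0'.
- by move=> z; rewrite eval_tp_cat fT gT'.
- by move=> l ln z; rewrite filter_cat eval_tp_cat ST// ST'.
Qed.

Lemma splits_sum D (I : Type) (r : seq I) f S :
  (forall i : I, splits D (f i) (S i)) ->
  splits D (fun z => \sum_(i <- r) f i z) (fun l z => \sum_(i <- r) S i l z).
Proof.
move=> h; elim: r => [|i r IH].
  by apply: eq_splits (splits0 D) => [z|l _ z]; rewrite big_nil.
by apply: eq_splits (splitsD (h i) IH) => [z|l _ z]; rewrite big_cons.
Qed.

(** The node contributes [M Q] times the odd number [2 l + 1 - 2 A], hence at least [M Q] in
    absolute value, while [q] contributes at most [12 * degree j * Q], which is less. So the node
    alone decides the sign. *)
Lemma half_plane_form_node l j i (q : int * int) : (l < 2 ^ n)%N ->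
  freq_le (3 * degree j) q ->
  if (l < split_point j i)%N
  then half_plane_form l (q + node_freq j i) < 0 < half_plane_form l (q - node_freq j i)
  else half_plane_form l (q - node_freq j i) < 0 < half_plane_form l (q + node_freq j i).
Proof.
move=> ln hq; have lQ : (l < Q)%N by exact: leq_trans leQ.
pose M := magnitude j; pose A := split_point j i.
have Em (e : int) : half_plane_form l (q.1 + e * - (M * A)%:Z, q.2 + e * (M * Q)%:Z) =
   half_plane_form l q + e * (M * Q)%:Z * (2 * l%:Z + 1 - 2 * A%:Z).
  rewrite /half_plane_form /= !(PoszM, PoszD); ring.
have hp : half_plane_form l (q + node_freq j i) =
    half_plane_form l q + (M * Q)%:Z * (2 * l%:Z + 1 - 2 * A%:Z).
  by rewrite -[in RHS](mul1r (M * Q)%:Z) -Em !mul1r.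
have hm : half_plane_form l (q - node_freq j i) =
    half_plane_form l q - (M * Q)%:Z * (2 * l%:Z + 1 - 2 * A%:Z).
  by rewrite -[in RHS]mulNr -[in RHS](mulN1r (M * Q)%:Z) -Em !mulN1r.
have hb : `|half_plane_form l q| < (M * Q)%:Z.
  move: hq; rewrite /freq_le /half_plane_form => /andP[h1 h2].
  have {}h1 : `|q.1| <= (3 * degree j)%:Z by lia.
  have {}h2 : `|q.2| <= (3 * degree j)%:Z by lia.
  apply: le_lt_trans (ler_normD _ _) _; rewrite !normrM.
  apply: (@le_lt_trans _ _ ((3 * degree j)%:Z * (2 * Q)%:Z + (2 * Q)%:Z * (3 * degree j)%:Z)).
    by apply: lerD; apply: ler_pM => //; lia.
  rewrite /M /magnitude; nia.
rewrite hp hm; move: hb; rewrite ltr_norml => /andP[b1 b2].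
case: ltnP => lA; rewrite -/A in lA.
  have : (M * Q)%:Z * (2 * l%:Z + 1 - 2 * A%:Z) <= (M * Q)%:Z * (-1).
    by rewrite ler_wpM2l//; lia.
  lia.
have : (M * Q)%:Z * 1 <= (M * Q)%:Z * (2 * l%:Z + 1 - 2 * A%:Z).
  by rewrite ler_wpM2l//; lia.
lia.
Qed.

(** The shift by [p] moves the whole spectrum of [g] to one side of each line, so the half-plane sum
    is everything or nothing, as [P l] says. *)
Lemma splits_twist D D' (g : R * R -> R[i]) p (P : pred nat) :
  trig_poly D g -> freq_le D' p ->
  (forall l q, (l < 2 ^ n)%N -> freq_le D q ->
    if P l then half_plane_form l (q + p) < 0 else 0 < half_plane_form l (q + p)) ->
  splits (D + D') (fun z => g z * expchar p z)
    (fun l z => if P l then g z * expchar p z else 0).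
Proof.
move=> [T hT gT] hp hP; exists (twist_tp p 1 T); split.
- by rewrite all_map; apply: sub_all hT => t /= ht; exact: freq_leD.
- move=> l ln; rewrite all_map; apply: sub_all hT => t /= ht.
  by have := hP l _ ln ht; case: (P l) => h; [rewrite lt_eqF|rewrite gt_eqF].
- by move=> z; rewrite eval_twist gT mul1r mulrC.
- move=> l ln z; have h t : t \in T -> (half_plane_form l (t.1 + p) < 0) = P l.
    move=> tT; have := hP l _ ln (allP hT _ tT); case: (P l) => // h.
    by apply/negbTE; rewrite -leNgt ltW.
  rewrite filter_map; have -> : [seq t <- T | preim (fun t => (t.1 + p, 1 * t.2))
      (fun t => half_plane_form l t.1 < 0) t] = if P l then T else [::].
    rewrite (eq_in_filter (a2 := fun=> P l)) => [|t tT /=]; last exact: h.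
    by case: (P l); rewrite ?filter_predT ?filter_pred0.
  case: (P l) => //=; last by rewrite eval_tp_nil.
  by rewrite -/(twist_tp p 1 T) eval_twist gT mul1r mulrC.
Qed.

Lemma splits_node j i (g : R * R -> R) : (j < n)%N -> (i < 2 ^ j)%N ->
  rtrig_poly (3 * degree j) g ->
  splits (degree j.+1) (fun z => (g z * cos (angle j i z))%:C)
    (fun l z => (g z / 2)%:C *
       expchar (if (l < split_point j i)%N then node_freq j i else - node_freq j i) z).
Proof.
move=> jn ij tg.
have tg2 : trig_poly (3 * degree j) (fun z => (g z / 2)%:C).
  by apply: eq_rtrig_poly (rtrig_polyZ 2^-1 tg) => z; rewrite mulrC.
have hf := node_freq_le jn ij.
have hNf : freq_le (magnitude j * (2 ^ n + Q)) (- node_freq j i) by rewrite freq_leN.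
have s1 := splits_twist (P := fun l => (l < split_point j i)%N) tg2 hf.
have s2 := splits_twist (P := fun l => ~~ (l < split_point j i)%N) tg2 hNf.
have hD := degreeS_ge j.
apply: splits_le (_ : (3 * degree j + magnitude j * (2 ^ n + Q) <= _)%N) _; first by lia.
apply: eq_splits (splitsD (s1 _) (s2 _)) => [z|l ln z|l q ln hq|l q ln hq].
- have -> : (g z / 2)%:C = (g z)%:C / 2 :> R[i].
    by rewrite rmorphM fmorphV rmorph_nat.
  by rewrite rmorphM /= cos_expi /expchar dotNl /angle; ring.
- by case: ltnP; rewrite ?addr0 ?add0r.
- by have := half_plane_form_node i ln hq; case: ifP => _ /andP[].
- by have := half_plane_form_node i ln hq; case: ifP => _ /andP[].
Qed.

(** * Half-plane sums of the walk *)

Fixpoint half_walk l j z : R[i] :=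
  if j is j'.+1 then half_walk l j' z + \sum_(i < 2 ^ j')
    (c * (1 - walk j' z ^+ 2) * weight j' i z / 2)%:C *
    expchar (if (l < split_point j' i)%N then node_freq j' i else - node_freq j' i) z
  else 0.

Lemma splits_walk j : (j <= n)%N ->
  splits (degree j) (fun z => (walk j z)%:C) (fun l => half_walk l j).
Proof.
elim: j => [|j IH] jn; first exact: splits0.
have h := degree_leS j.
have tq := rtrig_polyZ c (rtrig_polyB (rtrig_poly_cst _ 1)
  (rtrig_polyX 2 (rtrig_poly_walk (ltnW jn)))).
have s1 : splits (degree j.+1) (fun z => (walk j z)%:C) (fun l => half_walk l j).
  by apply: splits_le (IH (ltnW jn)); lia.
have deg3 : (2 * degree j + degree j <= 3 * degree j)%N by lia.
have tg (i : 'I_(2 ^ j)) := rtrig_poly_le deg3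
  (rtrig_polyM tq (rtrig_poly_weight (ltnW jn) (ltn_ord i))).
have s2 (i : 'I_(2 ^ j)) := splits_node jn (ltn_ord i) (tg i).
apply: eq_splits (splitsD s1 (splits_sum _ s2)) => [z|l ln z] //=.
rewrite rmorphD /=; congr (_ + _); rewrite mulr_sumr rmorph_sum.
by apply: eq_bigr => i _; rewrite mulrA.
Qed.

(** The real part is half the walk whatever [l] is, hence bounded; all growth is in the imaginary
    part, where the side of [l] at each node sets the sign of the sine. *)
Lemma Im_half_walk l j z : complex.Im (half_walk l j z) =
  \sum_(j' < j) c / 2 * ((1 - walk j' z ^+ 2) * \sum_(i < 2 ^ j') weight j' i z *
    ((-1) ^+ (split_point j' i <= l)%N * sin (angle j' i z))).
Proof.
elim: j => [|j IH]; first by rewrite big_ord0.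
rewrite big_ord_recr /= complex_ImD IH; congr (_ + _).
rewrite (big_morph (@complex.Im R) (id1 := 0) (op1 := +%R)) //; last exact: complex_ImD.
rewrite mulrA mulr_sumr; apply: eq_bigr => i _.
rewrite complex_ImM /= mul0r addr0; case: ltnP => _.
  by rewrite expr0 /angle /=; field.
by rewrite expr1 dotNl sinN /angle /=; field.
Qed.

Lemma weight_le_half j i z : weight j.+1 i z <= weight j i./2 z.
Proof.
rewrite /= ler_piMr ?weight_ge0//.
have /andP[h1 h2] := smooth_sign_sin_bound (angle j i./2 z).
by case: (odd i); rewrite ?expr1 ?expr0; lra.
Qed.

Lemma weight_le_ancestor j l z : (j <= n)%N ->
  weight n l z <= weight j (l %/ 2 ^ (n - j)) z.
Proof.
move=> jn; rewrite -{1}(subKn jn); elim: (n - j)%N (leq_subr j n) => [|m IH] mn.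
  by rewrite subn0 divn1.
apply: le_trans (IH (ltnW mn)) _.
have -> : (n - m = (n - m.+1).+1)%N by lia.
by apply: le_trans (weight_le_half _ _ _) _; rewrite expnSr divnMA divn2.
Qed.

(** Weights decrease along a path, so the ancestor of [l] at level [j] and the next one both weigh
    at least 15/16, which forces the sine at the first to have the sign of the turn towards [l]. *)
Lemma signed_sum_ge j l z : (j < n)%N -> (l < 2 ^ n)%N -> 15 / 16 <= weight n l z ->
  variation j z - 8^-1 <= \sum_(i < 2 ^ j) weight j i z *
    ((-1) ^+ (split_point j i <= l)%N * sin (angle j i z)).
Proof.
move=> jn ln hw.
pose a' := (l %/ 2 ^ (n - j.+1))%N.
pose a := (l %/ 2 ^ (n - j))%N.
have aa' : a = a'./2.
  by rewrite /a /a' -divn2 -divnMA -expnSr; congr (_ %/ 2 ^ _)%N; lia.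
have aj : (a < 2 ^ j)%N.
  by rewrite ltn_divLR ?expn_gt0// -expnD subnKC// ltnW.
have wa : 15 / 16 <= weight j a z.
  exact: le_trans hw (weight_le_ancestor l z (ltnW jn)).
(* [a'] is the child of [a] above [l]; it is the right one exactly when it is odd. *)
have sa : (split_point j a <= l)%N = odd a'.
  rewrite /split_point -leq_divRL ?expn_gt0// -/a' aa'.
  by have := odd_double_half a'; case: (odd a') => /=; lia.
have wa' := le_trans hw (weight_le_ancestor l z jn).
have s0 : 0 <= (-1) ^+ odd a' * sin (angle j a z).
  move: wa'; rewrite -/a' /= -aa' => wa'.
  have wle1 : weight j a z <= 1.
    rewrite -(weight_sum j z) (bigD1 (Ordinal aj))//= lerDl sumr_ge0// => i _.
    exact: weight_ge0.
  (* With the opposite sign the child would receive at most half of the weight of [a]. *)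
  rewrite leNgt; apply/negP => s0.
  have b0 : (-1) ^+ odd a' * smooth_sign k (sin (angle j a z)) <= 0.
    case: (odd a') s0; rewrite ?expr1 ?expr0 ?mulN1r ?mul1r => s0.
      by rewrite oppr_le0 smooth_sign_ge0 ?sin_sqr_le1//; lra.
    by rewrite smooth_sign_le0 ?sin_sqr_le1// ltW.
  have w0 := weight_ge0 j a z.
  move: wa' b0; move: (_ * smooth_sign _ _) => y; nra.
rewrite -subr_ge0 opprB [8^-1 - _]addrC addrA -sumrB (bigD1 (Ordinal aj))//= sa.
have sb (t : R) b : -1 <= (-1) ^+ b * sin t <= 1.
  by rewrite -ler_norml normrM normrX normrN1 expr1n mul1r; exact: sin_max.
(* On the path, [+- sin = |sin| >= sin ^+ 2]; off the path the total weight is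
   at most 1/16. *)
have t1 : 0 <= weight j a z * ((-1) ^+ odd a' * sin (angle j a z)) -
     weight j a z * sin (angle j a z) ^+ 2.
  rewrite -mulrBr mulr_ge0 ?weight_ge0// subr_ge0.
  have -> : sin (angle j a z) ^+ 2 = ((-1) ^+ odd a' * sin (angle j a z)) ^+ 2.
    by rewrite exprMn sqrr_sign mul1r.
  have /andP[_] := sb (angle j a z) (odd a').
  by move: s0; move: (_ * sin _) => y y0 y1; rewrite expr2 ler_piMr.
have t2 : - (8^-1) <= \sum_(i < 2 ^ j | i != Ordinal aj) (weight j i z *
     ((-1) ^+ (split_point j i <= l)%N * sin (angle j i z)) -
     weight j i z * sin (angle j i z) ^+ 2).
  apply: le_trans (_ : - 2 * \sum_(i < 2 ^ j | i != Ordinal aj) weight j i z <= _).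
    have := weight_sum j z; rewrite (bigD1 (Ordinal aj))//=; lra.
  rewrite mulr_sumr; apply: ler_sum => i _.
  rewrite -mulrBr mulrC ler_wpM2l ?weight_ge0//.
  have /andP[h1 h2] := sb (angle j i z) (split_point j i <= l)%N.
  have h3 := sin_sqr_le1 (angle j i z); lra.
lra.
Qed.

(* Controls at once the three ways in which a point can fail to have a leaf with
   a large half-plane sum; its mean is small. *)
Definition badness z : R :=
  16 / n%:R ^+ 2 * (\sum_(i < n) double_increment i z) ^+ 2 +
  8 / n%:R * \sum_(j < n) walk j z ^+ 2 + 16 * spread n z.

Lemma spread_ge0 j z : 0 <= spread j z.
Proof.
rewrite subr_ge0 -(weight_sum j z); apply: ler_sum => i _.
rewrite expr2 ler_piMr ?weight_ge0//.
rewrite -(weight_sum j z) (bigD1 i)//= lerDl sumr_ge0// => l _.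
exact: weight_ge0.
Qed.

Lemma badness_ge0 z : 0 <= badness z.
Proof.
rewrite !addr_ge0// mulr_ge0 ?spread_ge0// ?divr_ge0 ?sqr_ge0//.
by apply: sumr_ge0 => j _; exact: sqr_ge0.
Qed.

(** As the weights sum to 1, the sum of their squares is at most the largest of them. *)
Lemma heavy_leaf z : spread n z < 16^-1 ->
  exists2 l, (l < 2 ^ n)%N & 15 / 16 <= weight n l z.
Proof.
move=> hs; apply: contrapT => hn.
suff : 16^-1 <= spread n z by rewrite leNgt hs.
have : \sum_(i < 2 ^ n) weight n i z ^+ 2 <= 15 / 16.
  rewrite -[leRHS]mulr1 -[X in _ <= _ * X](weight_sum n z) mulr_sumr.
  apply: ler_sum => i _.
  rewrite expr2 ler_wpM2r ?weight_ge0// leNgt; apply/negP => hi.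
  by apply: hn; exists i => //; exact: ltW.
rewrite /spread; lra.
Qed.

(** Each term of [badness] is below 1, so [T <= n / 4], [W <= n / 8] and some leaf weighs at least
    15/16. The levels then add up to at least [(n - n / 4) / 2 - n / 8 - n / 8 = n / 8], the last
    [n / 8] being the loss in [signed_sum_ge]; the factor [c / 2] remains. *)
Lemma half_walk_large z : (0 < n)%N -> badness z < 1 ->
  exists2 l, (l < 2 ^ n)%N & c * n%:R / 16 <= complex.Im (half_walk l n z).
Proof.
move=> n0; rewrite /badness.
set T := \sum_(i < n) _; set W := \sum_(j < n) _ => hb.
have n0' : 0 < n%:R :> R by rewrite ltr0n.
have W0 : 0 <= W by apply: sumr_ge0 => j _; exact: sqr_ge0.
have T0 := sqr_ge0 T; have s0 := spread_ge0 n z.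
have cT : 0 <= 16 / n%:R ^+ 2 * T ^+ 2 by rewrite mulr_ge0 ?divr_ge0 ?sqr_ge0.
have cW : 0 <= 8 / n%:R * W by rewrite mulr_ge0 ?divr_ge0.
have [l ln hl] : exists2 l, (l < 2 ^ n)%N & 15 / 16 <= weight n l z.
  by apply: heavy_leaf; lra.
exists l => //.
have hT : T <= n%:R / 4.
  rewrite leNgt; apply/negP => hT.
  have : 1 < 16 / n%:R ^+ 2 * T ^+ 2; last by lra.
  rewrite mulrAC ltr_pdivlMr ?exprn_gt0// mul1r.
  have -> : 16 * T ^+ 2 = (4 * T) ^+ 2 by ring.
  by rewrite ltrXn2r// ?nnegrE; lra.
have hW : W <= n%:R / 8.
  have : 8 / n%:R * W <= 1 by lra.
  by rewrite mulrAC ler_pdivrMr// mul1r; lra.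
rewrite Im_half_walk -mulr_sumr.
have : \sum_(j < n) (variation j z - walk j z ^+ 2 - 8^-1) <=
  \sum_(j < n) ((1 - walk j z ^+ 2) * \sum_(i < 2 ^ j) weight j i z *
    ((-1) ^+ (split_point j i <= l)%N * sin (angle j i z))).
  apply: ler_sum => j _; have /andP[F0 F1] := walk_sqr j z.
  have := signed_sum_ge (ltn_ord j) ln hl.
  have V1 : 0 <= variation j z <= 1.
    have := double_increment_bound j z.
    by rewrite variation_double ler_norml => /andP[d1 d2]; apply/andP; split; lra.
  move: (\sum_(i < _) _) (variation j z) (walk j z ^+ 2) F0 F1 V1 => s v w w0 w1 /andP[v0 v1] sv.
  (* The damping costs at most [w], because [v <= 1]. *)
  apply: le_trans (_ : (1 - w) * (v - 8^-1) <= _); first by nra.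
  by rewrite ler_wpM2l// subr_ge0.
have -> : \sum_(j < n) (variation j z - walk j z ^+ 2 - 8^-1) =
    (n%:R - T) / 2 - W - n%:R / 8.
  rewrite !sumrB; congr (_ - _ - _).
    under eq_bigr do rewrite variation_double mulrBl.
    rewrite sumrB sumr_const card_ord mul1r mulrBl /T mulr_suml.
    by rewrite mulr_natl.
  by rewrite sumr_const card_ord mulr_natl.
move: (\sum_(j < n) _) => s hs.
have : c / 2 * (n%:R / 8) <= c / 2 * s by rewrite ler_wpM2l ?divr_ge0//; lra.
lra.
Qed.

Lemma mean_badness : (0 < n)%N ->
  exists2 D, rtrig_poly D badness &
  mean badness <= 16 / n%:R + 8 * n%:R * c ^+ 2 + 16 * n%:R * central_ratio (2 ^ k).
Proof.
move=> n0; pose D := (2 * degree n)%N.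
have n0' : 0 < n%:R :> R by rewrite ltr0n.
have t1 : rtrig_poly D (fun z => 16 / n%:R ^+ 2 * (\sum_(i < n) double_increment i z) ^+ 2).
  apply/rtrig_polyZ/(rtrig_polyX 2)/rtrig_poly_sum => i _.
  apply: rtrig_poly_le (rtrig_poly_double_increment (ltn_ord i)).
  by have := degreeS_ge i; have := degree_le (ltn_ord i); lia.
have tW (j : 'I_n) : rtrig_poly D (fun z => walk j z ^+ 2).
  apply: rtrig_poly_le (rtrig_polyX 2 (rtrig_poly_walk (ltnW (ltn_ord j)))).
  by rewrite leq_mul2l degree_le// ltnW.
have t2' : rtrig_poly D (fun z => \sum_(j < n) walk j z ^+ 2).
  by apply: rtrig_poly_sum => j _; exact: tW.
have t2 := rtrig_polyZ (8 / n%:R) t2'.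
have ts := rtrig_poly_spread (leqnn n).
have t3 := rtrig_polyZ 16 ts.
exists D; first exact: rtrig_polyD (rtrig_polyD t1 t2) t3.
rewrite /badness (meanD (rtrig_polyD t1 t2) t3) (meanD t1 t2).
have t0 : rtrig_poly D (fun z => (\sum_(i < n) double_increment i z) ^+ 2).
  apply/(rtrig_polyX 2)/rtrig_poly_sum => i _.
  apply: rtrig_poly_le (rtrig_poly_double_increment (ltn_ord i)).
  by have := degreeS_ge i; have := degree_le (ltn_ord i); lia.
rewrite (meanZ _ t0) (meanZ _ t2') (meanZ _ ts).
apply: lerD; first apply: lerD.
- have -> : 16 / n%:R = 16 / n%:R ^+ 2 * n%:R :> R by field; rewrite gt_eqF.
  by rewrite ler_wpM2l ?divr_ge0 ?sqr_ge0// mean_double_increment_sqr.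
- rewrite (mean_sum (D := D))//.
  have -> : 8 * n%:R * c ^+ 2 = 8 / n%:R * (n%:R * (n%:R * c ^+ 2)).
    by field; rewrite gt_eqF.
  rewrite ler_wpM2l ?divr_ge0//.
  have -> : n%:R * (n%:R * c ^+ 2) = \sum_(j < n) (n%:R * c ^+ 2).
    by rewrite sumr_const card_ord mulr_natl.
  apply: ler_sum => j _; apply: le_trans (mean_walk_sqr (ltnW (ltn_ord j))) _.
  by rewrite ler_wpM2r ?sqr_ge0// ler_nat ltnW.
- by rewrite -mulrA ler_wpM2l// mean_spread.
Qed.

End Tree.

(** * A bounded polynomial with large half-plane sums off a small set *)

Section DivergentBlock.
Context {R : realType}.
Implicit Types (z : R * R).
Local Notation mu := (@lebesgue2 R).
Local Notation T2 := (measurableTypeR R * measurableTypeR R)%type.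

Lemma normc_ge_abs_Im (x : R[i]) : `|complex.Im x| <= Normc.normc x.
Proof. by case: x => a b /=; rewrite -sqrtr_sqr ler_wsqrtr// lerDr sqr_ge0. Qed.

Lemma normc_ge_abs_Re (x : R[i]) : `|complex.Re x| <= Normc.normc x.
Proof. by case: x => a b /=; rewrite -sqrtr_sqr ler_wsqrtr// lerDl sqr_ge0. Qed.

Lemma normc_real (a : R) : Normc.normc a%:C = `|a|.
Proof. by rewrite /= expr0n addr0 sqrtr_sqr. Qed.

Lemma natr_above (x : R) : exists m, x <= m%:R.
Proof. by exists (Num.bound x); exact/ltW/unstable.ltr_bound. Qed.

Lemma central_ratio_small (e : R) : 0 < e ->
  exists k, central_ratio (2 ^ k) <= e.
Proof.
move=> e0; have [k hk] := natr_above (e ^- 2); exists k.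
rewrite leNgt; apply/negP => h.
have e2 : 0 < e ^+ 2 by rewrite exprn_gt0.
have := @central_ratio_bound R (2 ^ k); apply/negP; rewrite -ltNge.
have hN : e ^- 2 < (2 ^ k)%:R.
  by apply: le_lt_trans hk _; rewrite ltr_nat ltn_expl.
have : 1 < (2 ^ k)%:R * e ^+ 2 by rewrite -ltr_pdivrMr// div1r.
move=> /lt_trans; apply; rewrite ltr_pM2l; last first.
  by apply: lt_trans hN; rewrite invr_gt0.
by rewrite ltrXn2r// ?nnegrE; lra.
Qed.

(** Markov's inequality at height 1. The level set is cut down to [torus] because [mu] is the
    measure of the whole plane, where [f] is periodic. *)
Lemma markov_torus D (f : R * R -> R) (d : R) : rtrig_poly D f ->
  (forall z, 0 <= f z) -> mean f * (pi *+ 2) ^+ 2 <= d ->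
  exists B : set (R * R), [/\ measurable (B : set T2), (mu B <= d%:E)%E &
    forall z, torus z -> ~ B z -> f z < 1].
Proof.
move=> tf f0 fd.
have [mf bf] := rtrig_poly_bounded_measurable tf.
have mB : measurable ([set z | 1 <= f z] : set T2).
  have -> : [set z | 1 <= f z] = setT `&` f @^-1` `[1, +oo[.
    by rewrite setTI; apply/seteqP; split => z /=; rewrite in_itv/= andbT.
  by apply: mf => //; exact: measurable_itv.
have mt := @measurable_torus R.
exists ([set z | 1 <= f z] `&` torus); split.
- exact: measurableI.
- rewrite -[X in (X <= _)%E](integral_indic mu mt mB).
  apply: le_trans (_ : (\int[mu]_(z in torus) (f z)%:E <= _)%E).
    apply: ge0_le_integral => //.
    + by apply/measurable_EFinP; exact: measurable_indic.
    + by apply/measurable_EFinP; exact: measurable_funS mf.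
    + move=> z _; rewrite lee_fin indicE.
      by case: (boolP (z \in _)) => [/set_mem//|_]; rewrite f0.
  have := integrable_fin_num mt (integrable_torus (rtrig_poly_bounded_measurable tf)).
  move=> /fineK <-; rewrite lee_fin; apply: le_trans fd.
  by rewrite /mean divfK// gt_eqF// sqr_twopi_gt0.
- by move=> z tz /not_andP[|//] /negP; rewrite -ltNge.
Qed.

(** Each of the three terms bounding the mean of [badness] receives a third of [d']: the first by a
    large [m], the second by a small [eta], the third by a large [k] chosen after [n]. [K] asks for
    a large [m], and [e] for a large [Q]. *)
Lemma divergent_block (K d e : R) : 0 < d -> 0 < e ->
  exists (n Q D : nat) (T : seq ((int * int) * R[i])) (B : set (R * R)),
  [/\ [/\ (0 < Q)%N, (2 ^ n <= Q)%N, (2 ^ n)%:R <= e * Q%:R &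
        all (fun t => freq_le D t.1) T],
      forall l, (l < 2 ^ n)%N -> all (fun t => half_plane_form Q l t.1 != 0) T,
      forall z, Normc.normc (eval_tp T z) <= 1,
      measurable (B : set T2) /\ (mu B <= d%:E)%E &
      forall z, torus z -> ~ B z -> exists2 l, (l < 2 ^ n)%N &
        K <= Normc.normc (eval_tp [seq t <- T | half_plane_form Q l t.1 < 0] z)].
Proof.
move=> d0 e0; pose d' := d / (pi *+ 2) ^+ 2.
have d'0 : 0 < d' by rewrite divr_gt0// sqr_twopi_gt0.
(* With [n = m ^ 2] and [c = eta / m], the quantity [n * c ^ 2 = eta ^ 2] stays small while
   [c * n = eta * m] is as large as desired. *)
pose eta := Num.min (2^-1) (d' / 12).
have eta0 : 0 < eta by rewrite lt_min; apply/andP; split; lra.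
have eta1 : eta <= 2^-1 by rewrite ge_min lexx.
have eta2 : eta <= d' / 12 by rewrite ge_min lexx orbT.
have [m1 hm1] := natr_above (16 * K / eta).
have [m2 hm2] := natr_above (48 / d').
pose m := (maxn m1 m2).+1.
have m_gt0 : 0 < m%:R :> R by rewrite ltr0n.
have hm1' : 16 * K / eta <= m%:R.
  by apply: le_trans hm1 _; rewrite ler_nat leqW// leq_maxl.
have hm2' : 48 / d' <= m%:R.
  by apply: le_trans hm2 _; rewrite ler_nat leqW// leq_maxr.
have m_ge1 : 1 <= m%:R :> R by rewrite ler1n.
pose n := (m ^ 2)%N.
have nE : n%:R = m%:R ^+ 2 :> R by rewrite natrX.
have n0 : (0 < n)%N by rewrite expn_gt0.
have n_gt0 : 0 < n%:R :> R by rewrite ltr0n.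
have [k hk] : exists k, central_ratio (2 ^ k) <= d' / (48 * n%:R).
  by apply: central_ratio_small; rewrite divr_gt0// mulr_gt0.
have [q hq] := natr_above ((2 ^ n)%:R / e).
pose Q := maxn (2 ^ n) q.
have Q2 : (2 ^ n <= Q)%N by exact: leq_maxl.
pose c := eta / m%:R.
have c0 : 0 <= c by rewrite divr_ge0// ltW.
have c1 : c <= 2^-1.
  by rewrite ler_pdivrMr// (le_trans eta1)// ler_peMr.
have [D tb mb] := mean_badness k Q2 c0 c1 n0.
have mbd : mean (badness n Q k c) * (pi *+ 2) ^+ 2 <= d.
  rewrite -ler_pdivlMr ?sqr_twopi_gt0// -/d'; apply: le_trans mb _.
  have b1 : 16 / n%:R <= d' / 3.
    rewrite ler_pdivrMr// nE; apply: le_trans (_ : d' / 3 * m%:R <= _).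
      by move: hm2'; rewrite ler_pdivrMr// mulrC; lra.
    apply: ler_wpM2l; first lra.
    by rewrite expr2 ler_peMr// ltW.
  have b2 : 8 * n%:R * c ^+ 2 <= d' / 3.
    have -> : 8 * n%:R * c ^+ 2 = 8 * eta ^+ 2.
      by rewrite nE /c; field; rewrite gt_eqF.
    have : eta ^+ 2 <= 2^-1 * (d' / 12) by rewrite expr2 ler_pM// ltW.
    lra.
  have b3 : 16 * n%:R * central_ratio (2 ^ k) <= d' / 3.
    apply: le_trans (_ : 16 * n%:R * (d' / (48 * n%:R)) <= _).
      by rewrite ler_wpM2l// mulr_ge0.
    by rewrite le_eqVlt; apply/orP; left; apply/eqP; field; rewrite gt_eqF.
  lra.
have [B [mB muB hB]] := markov_torus tb (badness_ge0 n Q k c) mbd.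
have [T [TD T0 fT ST]] := splits_walk k Q2 c0 c1 (leqnn n).
exists n, Q, (degree n Q k n), T, B; split => //.
- split => //; first by apply: leq_trans Q2; rewrite expn_gt0.
  rewrite mulrC -ler_pdivrMr//; apply: le_trans hq _.
  by rewrite ler_nat leq_maxr.
- by move=> z; rewrite -fT normc_real walk_bound.
- move=> z tz Bz.
  have [l ln hl] := half_walk_large Q2 c0 c1 n0 (hB z tz Bz).
  exists l => //; rewrite -ST//; apply: le_trans (normc_ge_abs_Im _).
  apply: le_trans (ler_norm _).
  apply: le_trans hl.
  have -> : c * n%:R / 16 = eta * m%:R / 16.
    by rewrite /c nE; field; rewrite gt_eqF.
  by move: hm1'; rewrite ler_pdivrMr// mulrC; lra.
Qed.

End DivergentBlock.

(** * Partial sums, limits and discs *)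

Section PartialSums.
Context {R : realType}.
Implicit Types (z : R * R) (p : int * int).
Local Notation mu := (@lebesgue2 R).

Definition lattice_pt p : R * R := (p.1%:~R, p.2%:~R).

Lemma normcD (x y : R[i]) : Normc.normc (x + y) <= Normc.normc x + Normc.normc y.
Proof. exact: le_normcD. Qed.

Lemma normcN (x : R[i]) : Normc.normc (- x) = Normc.normc x.
Proof. by have := @complex.normcN R x. Qed.

Lemma normcB_ge (x y : R[i]) : Normc.normc y - Normc.normc x <= Normc.normc (x + y).
Proof.
rewrite lerBlDr; have -> : Normc.normc y = Normc.normc (x + y - x) by rewrite addrC addKr.
by rewrite -(normcN x) normcD.
Qed.

(** Coefficients are compared inside [U] only, so [f] may have an infinite spectrum. The sum over
    lattice points reduces to the distinct frequencies of [T] in [U], then is exchanged with the sum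
    over the entries of [T]. *)
Lemma partial_sum_eval (U : set (R * R)) f T z :
  (forall p, U (lattice_pt p) ->
    fourier_coef f p.1 p.2 = fourier_coef (eval_tp T : _ -> R[i]) p.1 p.2) ->
  partial_sum U f z.1 z.2 = eval_tp [seq t <- T | `[< U (lattice_pt t.1) >]] z.
Proof.
move=> fT; rewrite /partial_sum.
pose A := [set p | U (lattice_pt p)].
pose r := [seq p <- undup (map fst T) | p \in A].
rewrite -/A (fsbigE r); first last.
- move=> p Ap; rewrite mem_filter mem_undup mem_set//= => pT.
  rewrite fT// fourier_coef_eval big_seq_cond big1 ?mul0r// => t /andP[tT /eqP tp].
  by case/negP: pT; rewrite -tp; exact: map_f.
- by move=> p /=; rewrite mem_filter => /andP[/set_mem].
- by rewrite filter_uniq// undup_uniq.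
rewrite big_filter_cond /eval_tp big_filter.
under eq_bigr => p /andP[/set_mem pA _].
  rewrite fT// fourier_coef_eval mulr_suml.
  over.
rewrite (exchange_big_dep (fun t => `[< U (lattice_pt t.1) >])) /=; last first.
  by move=> p t /andP[/set_mem pA _] /eqP ->; exact/asboolP.
rewrite big_seq_cond [RHS]big_seq_cond; apply: eq_bigr => t /andP[tT /asboolP tU].
rewrite big_mkcond (bigD1_seq t.1) ?undup_uniq ?mem_undup ?map_f//=.
rewrite mem_set// eqxx big1 ?addr0 /=; first by case: z.
by move=> p pt; rewrite [t.1 == p]eq_sym (negbTE pt) andbF.
Qed.

(** The second property carries periodicity over to the limit. *)
Lemma geometric_limit (T : Type) (u : nat -> T -> R) :
  (forall k (z : T), `|u k.+1 z - u k z| <= 2 ^- k) ->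
  exists g, (forall k (z : T), `|g z - u k z| <= 2 * 2 ^- k) /\
    (forall z z' : T, (forall k, u k z = u k z') -> g z = g z').
Proof.
(* [u k + 2 * 2 ^- k] is nonincreasing in [k]. *)
move=> hu; exists (fun z : T => inf (range (fun k => u k z + 2 * 2 ^- k))); split; last first.
  by move=> z z' h; congr inf; apply/seteqP; split => x [k _ <-]; exists k; rewrite ?h.
have h2 k : 2 * 2 ^- k.+1 = 2 ^- k :> R.
  by rewrite exprS invfM mulrA divff ?mul1r// pnatr_eq0.
have up k m (z : T) : u (k + m)%N z - 2 * 2 ^- k <= u k z - 2 * 2 ^- (k + m) /\
   u k z + 2 * 2 ^- (k + m) <= u (k + m)%N z + 2 * 2 ^- k.
  elim: m => [|m [IH1 IH2]]; first by rewrite addn0.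
  have := hu (k + m)%N z; rewrite addnS ler_norml => /andP[a b].
  have h := h2 (k + m)%N; split; lra.
have p0 k : 0 < 2 ^- k :> R by rewrite invr_gt0 exprn_gt0.
have cross k m (z : T) : u k z - 2 * 2 ^- k <= u m z + 2 * 2 ^- m.
  have [/subnKC <-|/ltnW/subnKC <-] := leqP k m.
    by have [] := up k (m - k)%N z; have := p0 (k + (m - k))%N; lra.
  by have [] := up m (k - m)%N z; have := p0 (m + (k - m))%N; lra.
move=> k z; rewrite ler_norml; apply/andP; split.
  rewrite lerBrDl; apply: lb_le_inf; first by exists (u 0 z + 2 * 2 ^- 0); exists 0.
  by move=> _ [m _ <-]; have := cross k m z; lra.
rewrite lerBlDr addrC; apply: ge_inf; last by exists k.
by exists (u 0 z - 2 * 2 ^- 0) => _ [m _ <-]; exact: cross.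
Qed.

Lemma limit_continuous (u : nat -> R * R -> R) g :
  (forall k, continuous (u k)) ->
  (forall k z, `|g z - u k z| <= 2 * 2 ^- k) -> continuous g.
Proof.
move=> cu gu z; apply/cvgrPdist_lt => e e0.
have [m hm] := natr_above (8 / e).
have me : 2 * 2 ^- m < e / 3.
  have p0 : 0 < 2 ^+ m :> R by rewrite exprn_gt0.
  have : m%:R < 2 ^+ m :> R by rewrite -natrX ltr_nat ltn_expl.
  move=> /(le_lt_trans hm); rewrite ltr_pdivrMr// => h.
  by rewrite ltr_pdivrMr//; nra.
have /cvgrPdist_lt /(_ (e / 3)) := cu m z.
rewrite divr_gt0// => /(_ isT); apply: filterS => t ht.
have -> : g z - g t = (g z - u m z) + (u m z - u m t) - (g t - u m t) by ring.
have := gu m z; have := gu m t => g1 g2.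
apply: le_lt_trans (ler_normB _ _) _.
have := ler_normD (g z - u m z) (u m z - u m t); lra.
Qed.

Lemma limit_bounded_measurable (u : nat -> R * R -> R) g :
  (forall k, bounded_measurable (u k)) ->
  (forall k z, `|g z - u k z| <= 2 * 2 ^- k) -> bounded_measurable g.
Proof.
move=> bu gu; split; last first.
  have [_ [M hM]] := bu 0%N; exists (M + 2) => z.
  rewrite -[g z](subrK (u 0%N z)) addrC (le_trans (ler_normD _ _))// lerD//.
  by have := gu 0%N z; rewrite expr0 invr1 mulr1.
apply: (@measurable_fun_cvg _ _ _ _ u) => [k|z _]; first exact: (bu k).1.
apply/cvgrPdist_lt => e e0.
have [m hm] := natr_above (8 / e).
near=> k; apply: le_lt_trans (gu k z) _.
have p0 : 0 < 2 ^+ k :> R by rewrite exprn_gt0.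
have mk : m%:R <= k%:R :> R by rewrite ler_nat; near: k; exact: nbhs_infty_ge.
have : k%:R < 2 ^+ k :> R by rewrite -natrX ltr_nat ltn_expl.
move=> /(le_lt_trans (le_trans hm mk)); rewrite ltr_pdivrMr// => h.
by rewrite ltr_pdivrMr//; nra.
Unshelve. all: by end_near. Qed.

(** The real and imaginary parts of the integrand are sums of two products, each at most [e]; adding
    both parts gives the 4. *)
Lemma fourier_coef_small (h : R * R -> R[i]) (e : R) n m : cbounded_measurable h ->
  (forall z, `|complex.Re (h z)| <= e) -> (forall z, `|complex.Im (h z)| <= e) ->
  Normc.normc (fourier_coef h n m) <= 4 * e.
Proof.
move=> bh hr hi.
have e0 : 0 <= e by apply: le_trans (hr 0).
have be := cbounded_measurableM bh (cbounded_measurable_expchar (- (n, m))).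
have bnd (k : R * R -> R) : bounded_measurable k -> (forall z, `|k z| <= 2 * e) ->
    `|(\int[mu]_(z in torus) k z)%R| <= 2 * e * (pi *+ 2) ^+ 2.
  move=> bk ke; have mt := @measurable_torus R.
  apply: le_trans (le_normr_Rintegral mt (integrable_torus bk)) _.
  apply: le_trans (_ : (\int[mu]_(z in torus) (2 * e))%R <= _).
    apply: le_Rintegral => //.
    - apply: integrable_torus; split.
        by apply: measurableT_comp bk.1; exact: normr_measurable.
      by exists (2 * e) => z; rewrite normr_id.
    - by apply: integrable_torus; exact: bounded_measurable_cst.
  rewrite Rintegral_cst//.
  by rewrite [X in fine X]lebesgue2_torus.
have ab (x y c s : R) : `|x| <= e -> `|y| <= e -> `|c| <= 1 -> `|s| <= 1 ->
    `|x * c + y * s| <= 2 * e.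
  move=> hx hy hc hs; apply: le_trans (ler_normD _ _) _; rewrite !normrM.
  have -> : 2 * e = e * 1 + e * 1 by ring.
  by rewrite lerD// ler_pM.
have E : (fun z => h z * expi (- (n%:~R * z.1 + m%:~R * z.2))) =
   (fun z => h z * expchar (- (n, m)) z).
  by apply/funext => z; rewrite /expchar dotNl.
rewrite /fourier_coef E Normc.normcM normc_real ger0_norm; last first.
  by rewrite invr_ge0 ltW// sqr_twopi_gt0.
rewrite mulrC ler_pdivrMr ?sqr_twopi_gt0//.
have -> : 4 * e * (pi *+ 2) ^+ 2 = 2 * e * (pi *+ 2) ^+ 2 + 2 * e * (pi *+ 2) ^+ 2 by ring.
rewrite /cintegral.
have nab (a b : R) : Normc.normc (a +i* b) <= `|a| + `|b|.
  have -> : a +i* b = a%:C + b *i :> R[i] by simpc.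
  apply: le_trans (normcD _ _) _.
  by rewrite lerD//= expr0n ?addr0 ?add0r sqrtr_sqr.
apply: le_trans (nab _ _) _; apply: lerD; apply: bnd.
- exact: be.1.
- move=> z; rewrite complex_ReM -mulrN; apply: ab => //; rewrite ?normrN.
    exact: cos_max.
  exact: sin_max.
- exact: be.2.
- by move=> z; rewrite complex_ImM; apply: ab => //; [exact: sin_max|exact: cos_max].
Qed.

End PartialSums.

(** * Discs that act as half-planes on shifted spectra *)

Section Discs.
Context {R : realType}.
Implicit Types (N Q l D : nat) (z : R * R) (p : int * int).

Definition slope Q l : R := (2 * l + 1)%:R / (2 * Q)%:R.

Definition tangent_radius N Q l : R := N.+1%:R * Num.sqrt (1 + slope Q l ^+ 2).

Lemma tangent_radius_gt0 N Q l : 0 < tangent_radius N Q l.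
Proof. by rewrite mulr_gt0 ?ltr0n// sqrtr_gt0 ltr_wpDr ?sqr_ge0. Qed.

(* The boundary circle passes through [(N.+1, 0)], and there its tangent is the
   line [(x - N.+1) + slope Q l * y = 0]. *)
Definition tangent_disc N Q l : disc R :=
  Disc (0, - (slope Q l * N.+1%:R)) (tangent_radius_gt0 N Q l).

Lemma slope_ge0 Q l : 0 <= slope Q l.
Proof. by rewrite divr_ge0. Qed.

Lemma tangent_discE N Q l z : disc_set (tangent_disc N Q l) z <->
  z.1 ^+ 2 + z.2 ^+ 2 + 2 * slope Q l * N.+1%:R * z.2 < N.+1%:R ^+ 2.
Proof.
rewrite /disc_set /= /tangent_radius.
set s := slope Q l; set n : R := N.+1%:R.
have n0 : 0 < n by rewrite ltr0n.
have -> : n * Num.sqrt (1 + s ^+ 2) = Num.sqrt (n ^+ 2 * (1 + s ^+ 2)).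
  by rewrite sqrtrM ?sqr_ge0// sqrtr_sqr gtr0_norm.
rewrite ltr_sqrt; last by rewrite mulr_gt0 ?exprn_gt0// ltr_wpDr ?sqr_ge0.
rewrite -subr_gt0 -[X in _ <-> is_true X]subr_gt0.
by have -> : n ^+ 2 * (1 + s ^+ 2) - ((z.1 - 0) ^+ 2 + (z.2 - - (s * n)) ^+ 2) =
  n ^+ 2 - (z.1 ^+ 2 + z.2 ^+ 2 + 2 * s * n * z.2) by ring.
Qed.

Lemma slope_le1 Q l : (0 < Q)%N -> (l < Q)%N -> slope Q l <= 1.
Proof.
move=> Q0 lQ; rewrite ler_pdivrMr ?ltr0n ?muln_gt0// mul1r ler_nat; lia.
Qed.

Lemma tau_tangent_disc N Q l : 0 <= tau (tangent_disc N Q l) <= slope Q l.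
Proof.
rewrite divr_ge0 ?sqrtr_ge0 ?(ltW (tangent_radius_gt0 _ _ _))//=.
rewrite ler_pdivrMr ?tangent_radius_gt0// expr0n add0r sqrtr_sqr normrN.
rewrite ger0_norm ?mulr_ge0 ?slope_ge0// ler_wpM2l ?slope_ge0//.
rewrite ler_peMr// -[leLHS]sqrtr1 ler_wsqrtr// lerDl sqr_ge0//.
Qed.

Lemma tangent_disc_contains N Q l (A : R) z : (0 < Q)%N -> (l < Q)%N ->
  `|z.1| <= A -> `|z.2| <= A -> 2 * A ^+ 2 + 2 * A <= N%:R ->
  disc_set (tangent_disc N Q l) z.
Proof.
move=> Q0 lQ h1 h2 hN; apply/tangent_discE.
have s0 := slope_ge0 Q l; have s1 := slope_le1 Q0 lQ.
have A0 : 0 <= A by apply: le_trans h1.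
have nE : N.+1%:R = N%:R + 1 :> R by rewrite -natr1.
set n : R := N.+1%:R in nE *.
have sq (x : R) : `|x| <= A -> x ^+ 2 <= A ^+ 2.
  by move=> hx; rewrite -(real_normK (num_real x)) lerXn2r// nnegrE.
have := sq _ h1; have := sq _ h2 => q2 q1.
have : 2 * slope Q l * n * z.2 <= 2 * n * A.
  have : slope Q l * z.2 <= 1 * A.
    apply: le_trans (ler_norm _) _; rewrite normrM ler_pM//.
    by rewrite ger0_norm.
  have n0 : 0 <= 2 * n by rewrite mulr_ge0.
  have -> : 2 * slope Q l * n * z.2 = 2 * n * (slope Q l * z.2) by ring.
  by rewrite mul1r => hA; rewrite ler_wpM2l.
have : 0 <= A ^+ 2 by rewrite sqr_ge0.
have n1 : 1 <= n by rewrite ler1n.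
move: (A ^+ 2) q1 q2 hN => B q1 q2 hN B0 hs.
have : n * (2 * B + 2 * A + 1) <= n ^+ 2 by rewrite expr2 ler_wpM2l//; lra.
nra.
Qed.

(** The center has abscissa 0 and, the slope being at most 1, the radius is at most [sqrt 2] times
    [N.+1]. *)
Lemma tangent_disc_excludes N Q l z : (0 < Q)%N -> (l < Q)%N ->
  2 * N.+1%:R <= z.1 -> ~ disc_set (tangent_disc N Q l) z.
Proof.
move=> Q0 lQ h1 /tangent_discE.
have s0 := slope_ge0 Q l; have s1 := slope_le1 Q0 lQ.
have n0 : 0 < N.+1%:R :> R by rewrite ltr0n.
set n : R := N.+1%:R in h1 n0 *; set s := slope Q l in s0 s1 *.
have : (2 * n) ^+ 2 <= z.1 ^+ 2 by rewrite lerXn2r// nnegrE; lra.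
have := sqr_ge0 (z.2 + s * n).
have : s ^+ 2 * n ^+ 2 <= n ^+ 2.
  by rewrite ler_piMl ?sqr_ge0// exprn_ile1.
have : 0 < n ^+ 2 by rewrite exprn_gt0.
have -> : (2 * n) ^+ 2 = 4 * n ^+ 2 by ring.
have -> : (z.2 + s * n) ^+ 2 = z.2 ^+ 2 + 2 * s * n * z.2 + s ^+ 2 * n ^+ 2 by ring.
move: (2 * s * n * z.2) (s ^+ 2 * n ^+ 2) (n ^+ 2) (z.1 ^+ 2) (z.2 ^+ 2).
by move=> a b m x y; lra.
Qed.

(** Multiplied by [Q], the inequality of the disc at the shifted point reads
    [Q |p| ^ 2 + N.+1 * h < 0], with [h] the half-plane form. Since [h] is a nonzero integer and
    [Q |p| ^ 2 <= 2 Q D ^ 2 <= N], the sign is that of [h]. *)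
Lemma tangent_disc_lattice N Q l D p : (0 < Q)%N -> freq_le D p ->
  half_plane_form Q l p != 0 -> (2 * Q * D ^ 2 <= N)%N ->
  disc_set (tangent_disc N Q l) (lattice_pt (p + (N.+1%:Z, 0))) <->
  half_plane_form Q l p < 0.
Proof.
move=> Q0 hp h0 hN; apply: iff_trans (tangent_discE _ _ _ _) _.
pose h := half_plane_form Q l p.
have E : (p.1 + N.+1%:Z)%:~R ^+ 2 + (p.2 + 0)%:~R ^+ 2 +
   2 * slope Q l * N.+1%:R * (p.2 + 0)%:~R - N.+1%:R ^+ 2 =
   (Q%:Z * (p.1 ^+ 2 + p.2 ^+ 2) + N.+1%:Z * h)%:~R / Q%:R :> R.
  have Qr : Q%:R != 0 :> R by rewrite pnatr_eq0 -lt0n.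
  rewrite /h /half_plane_form /slope.
  rewrite !PoszM ?PoszD ?PoszM ?(rmorphD, rmorphM, rmorphXn) /=.
  rewrite ?natrM ?natrD ?natrM -?pmulrn ?addr0.
  by field; rewrite Qr /= -mulr2n mulrn_eq0.
rewrite /lattice_pt /= -subr_lt0 E pmulr_llt0 ?invr_gt0 ?ltr0n// ltrz0.
move: hp; rewrite /freq_le => /andP[d1 d2].
have {}d1 : p.1 ^+ 2 <= (D ^ 2)%:Z by rewrite expr2 -mulnn PoszM; nia.
have {}d2 : p.2 ^+ 2 <= (D ^ 2)%:Z by rewrite expr2 -mulnn PoszM; nia.
have e1 : 0 <= p.1 ^+ 2 by rewrite sqr_ge0.
have e2 : 0 <= p.2 ^+ 2 by rewrite sqr_ge0.
have b : Q%:Z * (p.1 ^+ 2 + p.2 ^+ 2) <= N%:Z.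
  apply: (@le_trans _ _ (Q%:Z * ((D ^ 2)%:Z + (D ^ 2)%:Z))); last by lia.
  by rewrite ler_wpM2l//; lia.
have b0 : 0 <= Q%:Z * (p.1 ^+ 2 + p.2 ^+ 2) by rewrite mulr_ge0// addr_ge0.
rewrite -/h in h0 *; split => hh; first by nia.
have : h <= -1 by lia.
nia.
Qed.

End Discs.

(** * Superposition of blocks *)

Section Assembly.
Context {R : realType}.
Implicit Types (k l j : nat) (z : R * R) (p : int * int).
Context (n Q D : nat -> nat) (T : nat -> seq ((int * int) * R[i])).
Context (Q_gt0 : forall k, (0 < Q k)%N).
Context (leaves_le : forall k, (2 ^ n k <= Q k)%N).
Context (T_freq : forall k, all (fun t => freq_le (D k) t.1) (T k)).
Context (T_form : forall k l, (l < 2 ^ n k)%N ->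
  all (fun t => half_plane_form (Q k) l t.1 != 0) (T k)).
Context (T_bound : forall k z, Normc.normc (eval_tp (T k) z) <= 1).

(* The summands make the discs of block [k] contain the spectra of the earlier
   blocks and cut block [k] along half-planes, keep the spectrum of block [k] out
   of the discs of the earlier blocks, and tend to infinity. *)
Definition freq_shift_of (a k : nat) : nat :=
  (2 * a ^ 2 + 2 * a + 2 * Q k * D k ^ 2 + D k + k)%N.

Fixpoint spectrum_bound k : nat :=
  if k is k'.+1 then ((freq_shift_of (spectrum_bound k') k').+1 + D k')%N else 0%N.

Definition freq_shift k := freq_shift_of (spectrum_bound k) k.

Definition block k := twist_tp ((freq_shift k).+1%:Z, 0) (2 ^- k)%:C (T k).

Fixpoint partial_blocks k := if k is k'.+1 then partial_blocks k' ++ block k' else [::].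

Definition block_disc k l : disc R := tangent_disc (freq_shift k) (Q k) l.

Lemma leaf_lt_Q k l : (l < 2 ^ n k)%N -> (l < Q k)%N.
Proof. by move=> h; exact: leq_trans (leaves_le k). Qed.

Lemma spectrum_bound_le j k : (j <= k)%N -> (spectrum_bound j <= spectrum_bound k)%N.
Proof.
move=> /subnKC <-; elim: (k - j)%N => [|m IH]; first by rewrite addn0.
by rewrite addnS /= /freq_shift_of; lia.
Qed.

Lemma partial_blocks_freq k :
  all (fun t => freq_le (spectrum_bound k) t.1) (partial_blocks k).
Proof.
elim: k => //= k IH; rewrite all_cat; apply/andP; split.
  apply: sub_all IH => t; rewrite /freq_le => /andP[h1 h2].
  by have := spectrum_bound_le (leqnSn k); rewrite /=; lia.
rewrite all_map; apply: sub_all (T_freq k) => t /= ht.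
by rewrite addnC; apply: freq_leD => //; rewrite /freq_le /= leqnn.
Qed.

Lemma intr_abs_le (a : int) m : (`|a| <= m)%N -> `|a%:~R : R| <= m%:R.
Proof. by move=> h; rewrite -intr_norm pmulrn ler_int; lia. Qed.

Lemma block_disc_contains k l p : (l < 2 ^ n k)%N ->
  freq_le (spectrum_bound k) p -> disc_set (block_disc k l) (lattice_pt p).
Proof.
move=> lk /andP[h1 h2].
apply: (tangent_disc_contains (A := (spectrum_bound k)%:R)) => //.
- exact: leaf_lt_Q.
- exact: intr_abs_le.
- exact: intr_abs_le.
- by rewrite -natrX -!natrM -natrD ler_nat /freq_shift /freq_shift_of; lia.
Qed.

Lemma block_disc_excludes k l j : (l < 2 ^ n k)%N -> (k < j)%N ->
  forall s, s \in block j -> ~ disc_set (block_disc k l) (lattice_pt s.1).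
Proof.
move=> lk kj s /mapP[r rT ->].
apply: tangent_disc_excludes => //; first exact: leaf_lt_Q.
have /andP[h1 _] := allP (T_freq j) _ rT.
have h := spectrum_bound_le kj.
rewrite /lattice_pt /= -natrM pmulrn ler_int.
rewrite /= -/(freq_shift k) in h.
have : (2 * spectrum_bound j + D j <= freq_shift j)%N by rewrite /freq_shift /freq_shift_of; lia.
lia.
Qed.

Lemma block_disc_filter k l : (l < 2 ^ n k)%N ->
  [seq t <- partial_blocks k.+1 | `[< disc_set (block_disc k l) (lattice_pt t.1) >]] =
  partial_blocks k ++ twist_tp ((freq_shift k).+1%:Z, 0) (2 ^- k)%:C
    [seq t <- T k | half_plane_form (Q k) l t.1 < 0].
Proof.
move=> lk; rewrite /= filter_cat; congr (_ ++ _).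
  apply/all_filterP; apply: sub_all (partial_blocks_freq k) => t ht.
  by apply/asboolP; exact: block_disc_contains.
rewrite /block /twist_tp filter_map; congr map.
apply: eq_in_filter => t tT /=.
have hf := allP (T_freq k) _ tT.
have h0 := allP (T_form lk) _ tT.
have hN : (2 * Q k * D k ^ 2 <= freq_shift k)%N by rewrite /freq_shift /freq_shift_of; lia.
have E := @tangent_disc_lattice R _ _ _ _ _ (Q_gt0 k) hf h0 hN.
by apply/asboolP/idP => /E.
Qed.

Lemma block_bound k z : Normc.normc (eval_tp (block k) z) <= 2 ^- k.
Proof.
rewrite eval_twist !Normc.normcM normc_expi mulr1 normc_real.
have p0 : 0 <= 2 ^- k :> R by rewrite invr_ge0 exprn_ge0.
by rewrite ger0_norm// ler_piMr.
Qed.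

Lemma partial_blocks_bound k z : Normc.normc (eval_tp (partial_blocks k) z) <= 2.
Proof.
suff : Normc.normc (eval_tp (partial_blocks k) z) <= 2 - 2 * 2 ^- k.
  by move=> /le_trans; apply; rewrite gerBl mulr_ge0// invr_ge0 exprn_ge0.
elim: k => [|k IH] /=.
  by rewrite eval_tp_nil Normc.normc0 expr0 invr1 mulr1 subrr.
rewrite eval_tp_cat; apply: le_trans (normcD _ _) _.
have h2 : 2 * 2 ^- k.+1 = 2 ^- k :> R.
  by rewrite exprS invfM mulrA divff ?mul1r// pnatr_eq0.
by have := block_bound k z; lra.
Qed.

Lemma continuous_dot p : continuous (@dot R p).
Proof.
move=> z; apply: cvgD.
  by apply: cvgM; [exact: cvg_cst|exact: cvg_fst].
by apply: cvgM; [exact: cvg_cst|exact: cvg_snd].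
Qed.

Lemma continuous_eval (s : seq ((int * int) * R[i])) :
  continuous (fun z => complex.Re (eval_tp s z)) /\
  continuous (fun z => complex.Im (eval_tp s z)).
Proof.
elim: s => [|r s [IH1 IH2]].
  have E : (eval_tp [::] : R * R -> R[i]) = fun=> 0.
    by apply/funext => z; rewrite eval_tp_nil.
  by rewrite E; split => z; exact: cvg_cst.
have E : eval_tp (r :: s) = fun z : R * R => r.2 * expchar r.1 z + eval_tp s z.
  by apply/funext => z; rewrite eval_tp_cons.
have cc z : cos (dot r.1 w) @[w --> z] --> cos (dot r.1 z).
  by apply: continuous_comp; [exact: continuous_dot|exact: continuous_cos].
have cs z : sin (dot r.1 w) @[w --> z] --> sin (dot r.1 z).
  by apply: continuous_comp; [exact: continuous_dot|exact: continuous_sin].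
have Er : (fun z => complex.Re (eval_tp (r :: s) z)) = fun z : R * R =>
    complex.Re r.2 * cos (dot r.1 z) - complex.Im r.2 * sin (dot r.1 z) +
    complex.Re (eval_tp s z).
  by apply/funext => z; rewrite E complex_ReD complex_ReM.
have Ei : (fun z => complex.Im (eval_tp (r :: s) z)) = fun z : R * R =>
    complex.Re r.2 * sin (dot r.1 z) + complex.Im r.2 * cos (dot r.1 z) +
    complex.Im (eval_tp s z).
  by apply/funext => z; rewrite E complex_ImD complex_ImM.
rewrite Er Ei; split => z.
  apply: cvgD; last exact: IH1.
  by apply: cvgB; apply: cvgM; [exact: cvg_cst|exact: cc|exact: cvg_cst|exact: cs].
apply: cvgD; last exact: IH2.
by apply: cvgD; apply: cvgM; [exact: cvg_cst|exact: cs|exact: cvg_cst|exact: cc].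
Qed.

Lemma complex_continuous (g h : R * R -> R) : continuous g -> continuous h ->
  continuous (fun z => g z +i* h z : R[i]).
Proof.
move=> cg ch z; apply/cvgrPdist_lt => e e0.
(* In the order of [R[i]], the positive elements are the positive reals. *)
have [Ie Re0] : complex.Im e = 0 /\ 0 < complex.Re e.
  by move: e0; rewrite ltcE /= => /andP[/eqP -> ->].
have eE : e = (complex.Re e)%:C by case: e Ie {e0 Re0} => a b /= ->.
have e2 : 0 < complex.Re e / 2 by rewrite divr_gt0.
have /cvgrPdist_lt /(_ _ e2) Hg := cg z.
have /cvgrPdist_lt /(_ _ e2) Hh := ch z.
apply: filterS2 Hg Hh => w hg hh.
rewrite eE normc_def ltcR /=.
apply: le_lt_trans (_ : `|g z - g w| + `|h z - h w| < _); last by lra.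
move: (g z - g w) (h z - h w) => a b.
have -> : `|a| + `|b| = Num.sqrt ((`|a| + `|b|) ^+ 2).
  by rewrite sqrtr_sqr [RHS]ger0_norm// addr_ge0.
rewrite ler_wsqrtr// sqrrD !real_normK ?num_real//.
by rewrite lerD2r lerDl mulrn_wge0// mulr_ge0.
Qed.

Lemma eval_periodic (s : seq ((int * int) * R[i])) z :
  eval_tp s (z + (pi *+ 2, 0)) = eval_tp s z /\
  eval_tp s (z + (0, pi *+ 2)) = eval_tp s z.
Proof.
have h (a : R) (m : int) : expi (a + m%:~R * pi *+ 2) = expi a.
  rewrite expiD -[RHS]mulr1; congr (_ * _).
  by rewrite /expi; have [-> ->] := @cos_sin_int2pi R m.
split; apply: eq_bigr => r _; congr (_ * _); rewrite /expchar /dot /=.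
  by rewrite addr0 mulrDr addrAC mulrnAr h.
by rewrite addr0 mulrDr addrA mulrnAr h.
Qed.

(** The blocks after [k] have no frequency in the discs of block [k]. Inside such a disc the
    coefficients of the uniform limit are thus those of [partial_blocks k.+1], of which the disc
    keeps the earlier blocks entirely and a half-plane part of block [k]. *)
Lemma limit_function : exists f : R * R -> R[i], continuous_on_torus f /\
  forall k l z, (l < 2 ^ n k)%N ->
    partial_sum (disc_set (block_disc k l)) f z.1 z.2 =
    eval_tp (partial_blocks k) z +
    (2 ^- k)%:C * expchar ((freq_shift k).+1%:Z, 0) z *
    eval_tp [seq t <- T k | half_plane_form (Q k) l t.1 < 0] z.
Proof.
have [g1 [g1u g1e]] : exists g1 : R * R -> R,
    (forall k z, `|g1 z - complex.Re (eval_tp (partial_blocks k) z)| <= 2 * 2 ^- k) /\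
    (forall z z', (forall k, complex.Re (eval_tp (partial_blocks k) z) =
                             complex.Re (eval_tp (partial_blocks k) z')) -> g1 z = g1 z').
  apply: geometric_limit => k z.
  rewrite /= eval_tp_cat complex_ReD addrAC subrr add0r.
  exact: le_trans (normc_ge_abs_Re _) (block_bound k z).
have [g2 [g2u g2e]] : exists g2 : R * R -> R,
    (forall k z, `|g2 z - complex.Im (eval_tp (partial_blocks k) z)| <= 2 * 2 ^- k) /\
    (forall z z', (forall k, complex.Im (eval_tp (partial_blocks k) z) =
                             complex.Im (eval_tp (partial_blocks k) z')) -> g2 z = g2 z').
  apply: geometric_limit => k z.
  rewrite /= eval_tp_cat complex_ImD addrAC subrr add0r.
  exact: le_trans (normc_ge_abs_Im _) (block_bound k z).
pose f z : R[i] := g1 z +i* g2 z.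
have bf : cbounded_measurable f.
  split.
    by apply: limit_bounded_measurable g1u => k; exact: (cbounded_measurable_eval _).1.
  by apply: limit_bounded_measurable g2u => k; exact: (cbounded_measurable_eval _).2.
have coef k p : Normc.normc (fourier_coef f p.1 p.2 -
    fourier_coef (eval_tp (partial_blocks k) : _ -> R[i]) p.1 p.2) <= 4 * (2 * 2 ^- k).
  pose h z := f z + (-1) * eval_tp (partial_blocks k) z.
  have b1 : cbounded_measurable (fun z : R * R => (-1) * eval_tp (partial_blocks k) z).
    apply: cbounded_measurableM (cbounded_measurable_eval _).
    exact: cbounded_measurable_cst.
  have -> : fourier_coef f p.1 p.2 -
    fourier_coef (eval_tp (partial_blocks k) : _ -> R[i]) p.1 p.2 =
    fourier_coef h p.1 p.2.
    by rewrite fourier_coefD// fourier_coefZ ?mulN1r//; exact: cbounded_measurable_eval.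
  apply: fourier_coef_small; first exact: cbounded_measurableD.
    by move=> z; rewrite /h complex_ReD mulN1r; have := g1u k z; case: (eval_tp _ _).
  by move=> z; rewrite /h complex_ImD mulN1r; have := g2u k z; case: (eval_tp _ _).
exists f; split.
  split.
  - by apply: complex_continuous;
      [apply: limit_continuous g1u|apply: limit_continuous g2u] => k;
      have [] := continuous_eval (partial_blocks k).
  - move=> z; congr (_ +i* _); [apply: g1e|apply: g2e] => k;
      by rewrite (eval_periodic _ z).1.
  - move=> z; congr (_ +i* _); [apply: g1e|apply: g2e] => k;
      by rewrite (eval_periodic _ z).2.
move=> k l z lk.
rewrite (partial_sum_eval (T := partial_blocks k.+1)).
  by rewrite block_disc_filter// eval_tp_cat eval_twist.
move=> p pU.
have stat m : fourier_coef (eval_tp (partial_blocks (k.+1 + m)) : _ -> R[i]) p.1 p.2 =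
    fourier_coef (eval_tp (partial_blocks k.+1) : _ -> R[i]) p.1 p.2.
  elim: m => [|m IH]; first by rewrite addn0.
  rewrite -IH addnS !fourier_coef_eval [partial_blocks _.+1]/= big_cat /=.
  rewrite [X in _ + X = _]big_seq_cond [X in _ + X = _]big1 ?addr0// => s /andP[sb /eqP sp].
  have kj : (k < k.+1 + m)%N by lia.
  by have := block_disc_excludes lk kj sb; rewrite sp.
apply/eqP; rewrite -subr_eq0; apply/eqP/Normc.eq0_normc.
set x := Normc.normc _.
have x0 : 0 <= x by rewrite /x; case: (_ - _) => a b; exact: sqrtr_ge0.
apply/eqP; rewrite eq_le x0 andbT leNgt; apply/negP => xp.
(* By [coef] and [stat], the gap [x] is at most [8 / 2 ^ (k.+1 + m)] for every [m]. *)
have [m hm] := natr_above (8 / x).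
have := coef (k.+1 + m)%N p; rewrite stat -/x; apply/negP; rewrite -ltNge.
have p2 : 0 < 2 ^+ (k.+1 + m) :> R by rewrite exprn_gt0.
have -> : 4 * (2 * 2 ^- (k.+1 + m)) = 8 / 2 ^+ (k.+1 + m) :> R by ring.
rewrite ltr_pdivrMr// mulrC -ltr_pdivrMr//.
apply: le_lt_trans hm _; rewrite -natrX ltr_nat.
exact: leq_ltn_trans (leq_addl k.+1 m) (ltn_expl _ _).
Qed.

End Assembly.

(** * Listing the discs of all blocks in one sequence *)

Section Enumeration.
Context (size : nat -> nat).
Context (size_gt0 : forall k, (0 < size k)%N).

(** Lexicographic successor among the pairs (block, leaf). The block number never decreases along
    the list, so limits over blocks become limits over discs. *)
Definition next_index (s : nat * nat) : nat * nat :=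
  if (s.2.+1 < size s.1)%N then (s.1, s.2.+1) else (s.1.+1, 0%N).

Definition nth_index t : nat * nat := iter t next_index (0%N, 0%N).

Lemma nth_index_lt t : ((nth_index t).2 < size (nth_index t).1)%N.
Proof.
elim: t => [|t IH]; first exact: size_gt0.
by rewrite /nth_index iterS -/(nth_index t) /next_index; case: ifP => //=.
Qed.

Lemma nth_index_le t t' : (t <= t')%N -> ((nth_index t).1 <= (nth_index t').1)%N.
Proof.
move=> /subnKC <-; elim: (t' - t)%N => [|m IH]; first by rewrite addn0.
apply: leq_trans IH _; rewrite addnS /nth_index iterS -/(nth_index _) /next_index.
by case: ifP => //=.
Qed.

Lemma nth_index_surj k l : (l < size k)%N -> exists t, nth_index t = (k, l).
Proof.
have step k' : (exists t, nth_index t = (k', 0%N)) ->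
    forall l', (l' < size k')%N -> exists t, nth_index t = (k', l').
  move=> h0; elim=> [//|l' IH] hl; have [t ht] := IH (ltnW hl).
  by exists t.+1; rewrite /nth_index iterS -/(nth_index t) ht /next_index /= hl.
suff h0 : exists t, nth_index t = (k, 0%N) by exact: step.
elim: k {l} => [|k IH]; first by exists 0%N.
have hs : ((size k).-1 < size k)%N by rewrite prednK.
have [t ht] := step k IH _ hs; exists t.+1.
by rewrite /nth_index iterS -/(nth_index t) ht /next_index /= prednK// ltnn.
Qed.

End Enumeration.

(** * Unbounded upper limits and null sets *)

Section Divergence.
Context {R : realType}.
Local Notation mu := (@lebesgue2 R).
Local Notation T2 := (measurableTypeR R * measurableTypeR R)%type.

Lemma limn_esup_unbounded (u : nat -> R) :
  (forall m : nat, exists2 t, (m <= t)%N & m%:R <= u t) ->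
  limn_esup (fun t => (u t)%:E) = +oo%E.
Proof.
move=> hu; apply/eqP; rewrite -leye_eq; apply: le_ereal_inf_tmp => _ [V [t0 _ tV] <-].
rewrite leye_eq; apply/eqP/eqyP => r r0.
have [m hm] := natr_above r.
have [t tm ut] := hu (maxn m t0).
apply: le_trans (_ : (u t)%:E <= _)%E.
  rewrite lee_fin (le_trans hm)// (le_trans _ ut)// ler_nat leq_maxl//.
apply: ereal_sup_ubound; exists t => //.
by apply: tV => /=; rewrite (leq_trans _ tm)// leq_maxr.
Qed.

(** The points that lie in all [B k] from [m] on lie in [B (m + q)] for every [q], and these
    measures tend to 0. *)
Lemma negligible_eventually (B : nat -> set (R * R)) :
  (forall k, measurable (B k : set T2)) ->
  (forall k, (mu (B k) <= (2 ^- k)%:E)%E) ->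
  mu.-negligible (\bigcup_m \bigcap_(k in [set k | (m <= k)%N]) B k).
Proof.
move=> mB muB; apply: negligible_bigcup => m.
have mI : measurable (\bigcap_(k in [set k | (m <= k)%N]) B k : set T2).
  by apply: bigcap_measurable => //; exists m => /=.
exists (\bigcap_(k in [set k | (m <= k)%N]) B k); split => //.
apply/eqP; rewrite eq_le measure_ge0 andbT.
apply/lee_addgt0Pr => e e0; rewrite add0e.
have [q hq] := natr_above (e^-1).
apply: le_trans (_ : (mu (B (m + q)%N) <= _)%E).
  by apply: le_measure; rewrite ?inE// => z; apply; rewrite /= leq_addr.
apply: le_trans (muB _) _; rewrite lee_fin.
rewrite -[leRHS]invrK lef_pV2 ?posrE ?invr_gt0 ?exprn_gt0//.
apply: le_trans hq _; rewrite -natrX ler_nat ltnW//.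
exact: leq_ltn_trans (leq_addl m q) (ltn_expl _ _).
Qed.

End Divergence.

Theorem theorem2 (R : realType) :
  exists (f : R * R -> R[i]) (U : nat -> disc R),
    [/\ continuous_on_torus f,
        complete_seq (fun k => disc_set (U k)),
        tau (U k) @[k --> \oo] --> 0 &
        {ae lebesgue2, forall z : R * R, torus z ->
          limn_esup (fun k =>
            (ComplexField.Normc.normc
               (partial_sum (disc_set (U k)) f z.1 z.2))%:E) = +oo%E}].
Proof.
(* Block [k] enters with the factor [2 ^- k] and the earlier blocks take away at most 2, so [k]
   remains. *)
pose K k : R := 2 ^+ k * (k%:R + 2).
have h2 k : 0 < 2 ^- k :> R by rewrite invr_gt0 exprn_gt0.
have hk k : 0 < k.+1%:R^-1 :> R by rewrite invr_gt0 ltr0n.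
have /choice [n /choice [Q /choice [D /choice [T /choice [B HB]]]]] :=
  fun k => divergent_block (K k) (h2 k) (hk k).
have Q0 k : (0 < Q k)%N by have [[]] := HB k.
have nQ k : (2 ^ n k <= Q k)%N by have [[]] := HB k.
have sl k : (2 ^ n k)%:R <= k.+1%:R^-1 * (Q k)%:R :> R by have [[]] := HB k.
have TD k : all (fun t => freq_le (D k) t.1) (T k) by have [[]] := HB k.
have Tf k : forall l, (l < 2 ^ n k)%N ->
  all (fun t => half_plane_form (Q k) l t.1 != 0) (T k) by have [] := HB k.
have T1 k : forall z, Normc.normc (eval_tp (T k) z) <= 1 by have [] := HB k.
have mB k : measurable (B k : set (measurableTypeR R * measurableTypeR R)%type).
  by have [_ _ _ []] := HB k.
have muB k : (lebesgue2 (B k) <= (2 ^- k)%:E)%E by have [_ _ _ []] := HB k.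
have [f [cf Sf]] := limit_function Q0 nQ TD Tf T1.
pose size k := (2 ^ n k)%N.
have size0 k : (0 < size k)%N by rewrite expn_gt0.
pose idx := nth_index size.
have idx_lt t : ((idx t).2 < 2 ^ n (idx t).1)%N by exact: nth_index_lt.
pose U t := block_disc Q D (idx t).1 (idx t).2 : disc R.
exists f, U; split => //.
- apply/seteqP; split => // z _.
  pose A := `|z.1| + `|z.2|.
  have [k hA] := natr_above (2 * A ^+ 2 + 2 * A).
  have [t ht] := nth_index_surj size0 (size0 k).
  exists t => //; rewrite /U /idx ht.
  apply: (tangent_disc_contains (A := A)) => //=.
  + by rewrite lerDl.
  + by rewrite lerDr.
  + by apply: le_trans hA _; rewrite ler_nat /freq_shift /freq_shift_of leq_addl.
- apply/cvgrPdist_lt => e e0.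
  have [k hk'] := natr_above (e^-1).
  have [t0 ht0] := nth_index_surj size0 (size0 k).
  exists t0 => // t /= tt.
  rewrite sub0r normrN /U.
  have /andP[tau0 tau1] := @tau_tangent_disc R (freq_shift Q D (idx t).1) (Q (idx t).1) (idx t).2.
  rewrite ger0_norm//; apply: le_lt_trans tau1 _.
  have kt : (k <= (idx t).1)%N by have := nth_index_le size tt; rewrite ht0.
  set j := (idx t).1 in kt *.
  have lj := idx_lt t; rewrite -/j in lj.
  have Qj : 0 < (Q j)%:R :> R by rewrite ltr0n.
  (* [2 l + 1 <= 2 * 2 ^ n j], and [Q j] was chosen with [2 ^ n j <= Q j / j.+1]. *)
  apply: le_lt_trans (_ : _ <= j.+1%:R^-1) _.
    rewrite /slope ler_pdivrMr ?ltr0n ?muln_gt0 ?Q0//.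
    have := sl j; rewrite natrM mulrCA => hsl.
    apply: le_trans (_ : 2 * (2 ^ n j)%:R <= _); last by rewrite ler_wpM2l.
    by rewrite -natrM ler_nat; lia.
  rewrite -[ltRHS]invrK ltf_pV2 ?posrE ?invr_gt0 ?ltr0n//.
  by apply: le_lt_trans hk' _; rewrite ltr_nat.
- apply: negligibleS (negligible_eventually mB muB) => z /= nz.
  apply: contrapT => hz; apply: nz => tz.
  apply: limn_esup_unbounded => m.
  have [t0 ht0] : exists t0, (idx t0).1 = ((idx m).1 + m).+1.
    by have [t ht] := nth_index_surj size0 (size0 ((idx m).1 + m).+1); exists t; rewrite /idx ht.
  (* Blocks from [k0] on have their discs listed after position [m], and their numbers exceed
     [m]. *)
  set k0 := ((idx m).1 + m).+1 in ht0.
  have [k k0k nBk] : exists2 k, (k0 <= k)%N & ~ B k z.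
    apply: contrapT => h; apply: hz; exists k0 => // k /= kk.
    by apply: contrapT => nB; apply: h; exists k.
  have [_ _ _ _ /(_ z tz nBk) [l lk hl]] := HB k.
  have [t ht] := nth_index_surj size0 lk.
  exists t.
    rewrite leqNgt; apply/negP => tm.
    by have := nth_index_le size (ltnW tm); rewrite ht /= -/idx; lia.
  rewrite /U /idx ht /= Sf//.
  have P2 := partial_blocks_bound Q D T1 k z.
  apply: le_trans (normcB_ge _ _).
  have -> : Normc.normc ((2 ^- k)%:C * expchar ((freq_shift Q D k).+1%:Z, 0) z *
     eval_tp [seq t <- T k | half_plane_form (Q k) l t.1 < 0] z) =
     2 ^- k * Normc.normc (eval_tp [seq t <- T k | half_plane_form (Q k) l t.1 < 0] z).
    by rewrite !Normc.normcM normc_expi mulr1 normc_real ger0_norm// ltW.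
  have : 2 ^- k * K k <= 2 ^- k *
    Normc.normc (eval_tp [seq t <- T k | half_plane_form (Q k) l t.1 < 0] z).
    by rewrite ler_wpM2l// ltW.
  rewrite {1}/K mulKf ?expf_neq0 ?pnatr_eq0// => h.
  have : m%:R <= k%:R :> R by rewrite ler_nat; lia.
  lra.
Qed.
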